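(* Let $n\in\mathbb{N}$, $\mathcal H\in C^2(\mathbb{R}^{2n})$, and consider $\dot x=J_{2n}\nabla\mathcal H(x)$ with flow $\Phi^t$. Let $K\subset\mathbb{R}^{2n}$ be nonempty, compact and forward invariant for times in $[0,T]$ with $T\in(0,\infty]$, i.e. $\Phi^t(K)\subset K$ for all $t\in[0,T]$. Let $L_K:=\sup_{y\in K}\|\nabla^2\mathcal H(y)\|_2<\infty$ and $\Delta T_K^\star:=\min\{T,\ \log 2/L_K\}$ (with $\log2/L_K:=+\infty$ if $L_K=0$). Then for every fixed $\Delta T$ with $0<\Delta T<\Delta T_K^\star$: for every $x\in K$ the lower-right block $\mathbf D(x)=\partial_p\mathbf P(x)$ of $D\Phi^{\Delta T}(x)$ is invertible; and on any $(q,P)$-chart $(U,\psi)$ with $U\cap K\ne\emptyset$ whose coordinate image $W:=\psi(U)$ is simply connected, $\mathbf D$ is invertible on $U$, $\psi$ is a diffeomorphism onto the simply connected open set $W$, and there exists a generating function $S$ on $W$ such that, with $\mathbf p,\mathbf Q$ viewed as functions of $(q,P)$ (i.e. $(q,\mathbf p(q,P))=\psi^{-1}(q,P)$, $\mathbf Q(q,P)=\mathbf Q(q,\mathbf p(q,P))$), \[ \mathbf p(q,P)=\partial_qS(q,P),\qquad \mathbf Q(q,P)=\partial_PS(q,P), \] and $S^{\Delta T}(q,P):=\frac1{\Delta T}(S(q,P)-q^\top P)$ satisfies $J_{2n}^\top\frac{\Phi^{\Delta T}(x)-x}{\Delta T}=\nabla_{(q,P)}S^{\Delta T}(I_1x+I_2\Phi^{\Delta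 T}(x))$ for all $x\in U$; these statements hold for all $x\in K$ and all $0<\Delta T<\Delta T_K^\star$.
   Context: $J_{2n}=\begin{bmatrix}0_n&I_n\\-I_n&0_n\end{bmatrix}$, $I_1=\begin{bmatrix}I_n&0\\0&0\end{bmatrix}$, $I_2=\begin{bmatrix}0&0\\0&I_n\end{bmatrix}$. Write $\Phi^{\Delta T}(q,p)=(\mathbf Q(q,p),\mathbf P(q,p))$ with $x=(q,p)\in\mathbb{R}^n\times\mathbb{R}^n$, and $D\Phi^{\Delta T}=\begin{pmatrix}\mathbf A&\mathbf B\\\mathbf C&\mathbf D\end{pmatrix}$ in $n\times n$ blocks. A $(q,P)$-chart $(U,\psi)$ is an open set $U\subset\mathbb{R}^{2n}$ on which $\Phi^{\Delta T}$ is defined, together with the map $\psi(q,p):=(q,\mathbf P(q,p))$, which is a diffeomorphism from $U$ onto the open set $\psi(U)$. *)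

(* Defs.v *)
From HB Require Import structures.
From mathcomp Require Import all_boot all_order all_algebra.
From mathcomp Require Import all_classical all_reals all_analysis.
Set Implicit Arguments. Unset Strict Implicit. Unset Printing Implicit Defensive.
Import Order.TTheory GRing.Theory Num.Theory.
Import numFieldNormedType.Exports.
Local Open Scope classical_set_scope.
Local Open Scope ring_scope.

Section Defs.
Variable R : realType.
Variable n : nat.

(* phase space R^{2n}, points x = (q,p) written as row vectors row_mx q p *)
Notation V := 'rV[R]_(n + n).

Definition Jmx : 'M[R]_(n + n) := block_mx 0 1%:M (- 1%:M) 0.
Definition I1mx : 'M[R]_(n + n) := block_mx 1%:M 0 0 0.
Definition I2mx : 'M[R]_(n + n) := block_mx 0 0 0 1%:M.

Definition partial (W : normedModType R) (i : 'I_(n + n)) (f : V -> W) (x : V) : W :=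
  'D_(delta_mx 0 i) f x.

Definition grad (f : V -> R) (x : V) : V := \row_i partial i f x.
Definition hess (f : V -> R) (x : V) : 'M[R]_(n + n) :=
  \matrix_(i, j) partial j (partial i f) x.

Definition C2 (f : V -> R) : Prop :=
  (forall i x, derivable f x (delta_mx 0 i)) /\
  (forall i j x, derivable (partial i f) x (delta_mx 0 j)) /\
  (forall i, continuous (partial i f)) /\
  (forall i j, continuous (partial j (partial i f))).

(* Jacobian matrix, standard convention: (Df x) i j = d f_i / d x_j *)
Definition jac (f : V -> V) (x : V) : 'M[R]_(n + n) := (lin1_mx ('d f x))^T.

Definition enorm (v : V) : R := Num.sqrt (\sum_i v 0 i ^+ 2).
Definition opnorm2 (A : 'M[R]_(n + n)) : R :=
  sup [set enorm (v *m A^T) | v in [set v : V | enorm v = 1]].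

(* gamma solves  dx/dt = J grad H(x)  (column convention), i.e. in row
   convention  gamma' = grad H(gamma) * J^T, on the open interval ]a, b[ *)
Definition is_solution (H : V -> R) (gamma : R -> V) (a b : R) : Prop :=
  forall s, a < s < b ->
    derivable gamma s 1 /\ derive1 gamma s = grad H (gamma s) *m Jmx^T.

Definition flow_dom (H : V -> R) (t : R) (x : V) : Prop :=
  exists (gamma : R -> V) (eps : R), 0 < eps /\ gamma 0 = x /\
    is_solution H gamma (Num.min 0 t - eps) (Num.max 0 t + eps).

(* the flow map Phi^t (its value is meaningful where flow_dom H t x holds;
   solutions are unique since H is C^2) *)
Definition flow (H : V -> R) (t : R) (x : V) : V :=
  xget x [set y | exists (gamma : R -> V) (eps : R), 0 < eps /\ gamma 0 = x /\
    is_solution H gamma (Num.min 0 t - eps) (Num.max 0 t + eps) /\ gamma t = y].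

Definition LK (H : V -> R) (K : set V) : R := sup [set opnorm2 (hess H y) | y in K].

(* Delta T_K^* = min(T, log 2 / L_K), with log 2 / 0 = +oo *)
Definition DTstar (H : V -> R) (K : set V) (T : \bar R) : \bar R :=
  if LK H K == 0 then T else Order.min T (ln 2 / LK H K)%:E.

Definition C1_on (f : V -> V) (U : set V) : Prop :=
  (forall x, U x -> differentiable f x) /\
  (forall x, U x -> {for x, continuous (jac f)}).
Definition diffeo_onto (f : V -> V) (U : set V) : Prop :=
  open U /\ open (f @` U) /\ {in U &, injective f} /\ C1_on f U /\
  exists g : V -> V, (forall x, U x -> g (f x) = x) /\
    (forall y, (f @` U) y -> U (g y) /\ f (g y) = y) /\ C1_on g (f @` U).

Definition psi (H : V -> R) (dT : R) (x : V) : V :=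
  row_mx (lsubmx x) (rsubmx (flow H dT x)).

Definition qP_chart (H : V -> R) (dT : R) (U : set V) : Prop :=
  open U /\ (forall x, U x -> flow_dom H dT x) /\ diffeo_onto (psi H dT) U.

Definition I01 : set R := `[0, 1]%classic.
Definition cpath (W : set V) (g : R -> V) : Prop :=
  {within I01, continuous g} /\ (forall s, I01 s -> W (g s)).
Definition simply_connected (W : set V) : Prop :=
  (forall a b, W a -> W b -> exists g, cpath W g /\ g 0 = a /\ g 1 = b) /\
  (forall g, cpath W g -> g 0 = g 1 ->
     exists h : R * R -> V,
       {within I01 `*` I01, continuous h} /\
       (forall s t, I01 s -> I01 t -> W (h (s, t))) /\
       (forall s, I01 s -> h (s, 0) = g s /\ h (s, 1) = g 0) /\
       (forall t, I01 t -> h (0, t) = g 0 /\ h (1, t) = g 0)).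

Definition qP (y : V) : R := \sum_i (lsubmx y) 0 i * (rsubmx y) 0 i.

End Defs.

(* Main.v *)
(* Write (Q, P) for the flow at time t = dT. The flow is exact symplectic: with
   the action A x = int_0^t (p . q' - H) along the trajectory of x, one has
   A y - A x = P . (Q y - Q x) - p . (q y - q x) + O(|y - x|^2).
   Hence S := (P . Q - A) o psi^-1 satisfies dS = Q . dP + p . dq on psi(U), so a
   generating function is given by an explicit formula, without a Poincare lemma.
   For x in K and v = (0, u), the solution w of the variational equation with
   w 0 = v satisfies |w t - v| <= (e^(L_K t) - 1) |v| < |v|, whereas the p-part of
   w t is D(x) u; so D(x) u = 0 forces u = 0. On a chart, D is invertible because
   it is the only nontrivial diagonal block of the derivative of psi. *)
Require Import Defs.
From HB Require Import structures.
From mathcomp Require Import all_boot all_order all_algebra.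
From mathcomp Require Import all_classical all_reals all_analysis.
From mathcomp Require Import ring lra.
Set Implicit Arguments. Unset Strict Implicit. Unset Printing Implicit Defensive.
Import Order.TTheory GRing.Theory Num.Theory.
Import numFieldNormedType.Exports.
Local Open Scope classical_set_scope.
Local Open Scope ring_scope.

(** * One-variable calculus and Picard iteration *)

(** [H] is only C^2, so its field is only C^1 and not globally Lipschitz, and [flow] is merely a
    choice among endpoints of integral curves. The obstacle is to turn this into a differentiable
    map. A global Picard theorem is applied to the field clamped to a box, and Gronwall shows that
    curves starting near a given one never reach the part of space where clamping changes the field.
    Differentiability then comes from comparing such a curve with the variational equation. The
    action is compared along two neighbouring curves by differentiating in time only. Since the
    second derivatives of [H] bound the discrepancy, the error is quadratic in the distance of the
    initial points. On the chart, Lipschitz continuity of the inverse of [psi] at one point converts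
    quadratic errors in x into quadratic errors in (q, P), which is how [S] becomes
    differentiable. *)

Lemma is_derive_le (R : realType) (f g df dg : R -> R) (a b : R) : a <= b ->
  (forall s, a <= s <= b -> is_derive s 1 f (df s)) ->
  (forall s, a <= s <= b -> is_derive s 1 g (dg s)) ->
  (forall s, a <= s <= b -> df s <= dg s) ->
  f b - f a <= g b - g a.
Proof.
move=> ab hf hg le_d.
have hd s : a <= s <= b -> is_derive s 1 (g - f) (dg s - df s).
  by move=> sab; have := hf _ sab; have := hg _ sab => ? ?; exact: is_deriveB.
have ioo s : s \in `]a, b[ -> a <= s <= b.
  by rewrite in_itv /= => /andP[/ltW -> /ltW ->].
have [|c cab e] := @MVT_segment R (g - f) (fun s => dg s - df s) a b ab
    (fun s h => hd s (ioo s h)).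
  apply: derivable_within_continuous => s; rewrite in_itv /= => /hd hs.
  exact: ex_derive.
have cab' : a <= c <= b by move: cab; rewrite in_itv.
rewrite -subr_ge0 (_ : _ - _ = (g - f) b - (g - f) a); last first.
  by rewrite !fctE; ring.
by rewrite e mulr_ge0 // subr_ge0 // le_d.
Qed.

Lemma is_derive_eq_on (R : realType) (f g d : R -> R) (a b : R) : a <= b ->
  (forall s, a <= s <= b -> is_derive s 1 f (d s)) ->
  (forall s, a <= s <= b -> is_derive s 1 g (d s)) ->
  f b - f a = g b - g a.
Proof.
move=> ab hf hg; apply/eqP; rewrite eq_le; apply/andP.
by split; apply: (is_derive_le ab (df := d) (dg := d)).
Qed.

Lemma continuous_primitive_ray (R : realType) (f : R -> R) (a : R) :
  continuous f ->
  exists F : R -> R, forall s : R, a < s -> is_derive s 1 F (f s).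
Proof.
move=> cf; pose F x := (\int[lebesgue_measure]_(t in [set` `[a, x]]) (f t))%R.
exists F => s lt_as.
have := @continuous_FTC1_closed R f a s (s + 1).
case; first by rewrite ltrDl.
- apply: continuous_compact_integrable; first exact: segment_compact.
  exact: continuous_subspaceT.
- exact: lt_as.
- exact: cf.
- by move=> dF dFE; apply: (DeriveDef dF); rewrite -derive1E; exact: dFE.
Qed.

(** The integral from [a] is a primitive only on the ray to the right of [a]. Primitives with
    different bases agree once they are normalised to vanish at 0, so the value at [s] may use the
    base [- (|s| + 1)], which lies to the left of both 0 and [s]. *)
Lemma continuous_primitive (R : realType) (f : R -> R) : continuous f ->
  exists F : R -> R, F 0 = 0 /\ forall s : R, is_derive s 1 F (f s).
Proof.
move=> cf.
have /choice[G hG] (a : R) := continuous_primitive_ray a cf.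
have lt_norm (s : R) : - (`|s| + 1) < s.
  by rewrite ltrNl (le_lt_trans (ler_norm _)) // normrN ltrDl.
have lt_norm0 (s : R) : - (`|s| + 1) < 0.
  by rewrite oppr_lt0 ltr_wpDl.
pose F s := G (- (`|s| + 1)) s - G (- (`|s| + 1)) 0.
have FE (a s : R) : a < s -> a < 0 -> F s = G a s - G a 0.
  move=> lt_as lt_a0.
  have [s0|s0] := leP 0 s.
    apply: (is_derive_eq_on s0 (d := f)) => r /andP[r0 rs]; apply: hG.
      exact: lt_le_trans r0.
    exact: lt_le_trans r0.
  apply: oppr_inj; rewrite !opprB.
  by apply: (is_derive_eq_on (ltW s0) (d := f)) => r /andP[sr r0]; apply: hG;
    apply: lt_le_trans sr.
exists F; split; first by rewrite /F subrr.
move=> s; pose a := - (`|s| + 1).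
have ha : is_derive s 1 (G a - cst (G a 0)) (f s).
  have := hG a s (lt_norm s) => ?.
  by rewrite -[f s]subr0; apply: is_deriveB.
apply: near_eq_is_derive ha.
near=> r; rewrite (FE a) //; last exact: lt_norm0.
by near: r; apply: lt_nbhsr; apply: lt_norm.
Unshelve. all: by end_near. Qed.

Section pointwise_is_derive.
Variables (R : realType) (V : normedModType R).
Implicit Types (f g : V -> R) (x v : V) (a b c : R).

Lemma is_derive_addf f g x v a b : is_derive x v f a -> is_derive x v g b ->
  is_derive x v (fun r => f r + g r) (a + b).
Proof. exact: is_deriveD. Qed.

Lemma is_derive_subf f g x v a b : is_derive x v f a -> is_derive x v g b ->
  is_derive x v (fun r => f r - g r) (a - b).
Proof. exact: is_deriveB. Qed.

Lemma is_derive_oppf f x v a : is_derive x v f a ->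
  is_derive x v (fun r => - f r) (- a).
Proof. exact: is_deriveN. Qed.

Lemma is_derive_cmulf c f x v a : is_derive x v f a ->
  is_derive x v (fun r => c * f r) (c * a).
Proof. by move=> h; exact: (@is_deriveZ _ _ _ f c x v a h). Qed.

Lemma is_derive_mulf f g x v a b : is_derive x v f a -> is_derive x v g b ->
  is_derive x v (fun r => f r * g r) (f x * b + g x * a).
Proof. by move=> hf hg; exact: (@is_deriveM _ _ f g x v a b hf hg). Qed.

Lemma is_derive_sumf (I : finType) (h : I -> V -> R) x v (d : I -> R) :
  (forall i, is_derive x v (h i) (d i)) ->
  is_derive x v (fun r => \sum_i h i r) (\sum_i d i).
Proof.
move=> hd; rewrite (_ : (fun _ => _) = fun r => \sum_(i <- index_enum I) h i r) //.
elim: (index_enum I) => [|i s IH].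
  rewrite big_nil (_ : (fun _ => _) = cst 0); first exact: is_derive_cst.
  by apply/funext => r; rewrite big_nil.
rewrite big_cons (_ : (fun _ => _) = fun r => h i r + \sum_(j <- s) h j r).
  exact: is_derive_addf.
by apply/funext => r; rewrite big_cons.
Qed.

End pointwise_is_derive.

Lemma is_derive_rVP (R : realType) m (u : R -> 'rV[R]_m) (s : R) (v : 'rV[R]_m) :
  is_derive s 1 u v <->
  forall i, is_derive s 1 (fun r => u r 0 i) (v 0 i).
Proof.
split=> [[du <-] i|h].
  split; first by move/derivable_mxP : du.
  by rewrite derive_mx // mxE.
have du : derivable u s 1.
  by apply/derivable_mxP => j i; rewrite (ord1 j); apply: ex_derive.
split=> //; rewrite derive_mx //; apply/rowP => i; rewrite mxE.
by apply: derive_val.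
Qed.

Lemma rV_norm_le (R : realType) m (v : 'rV[R]_m) (e : R) : 0 <= e ->
  (forall i, `|v 0 i| <= e) -> `|v| <= e.
Proof.
move=> e0 h; rewrite /Num.Def.normr /= mx_normrE.
by apply: bigmax_le => // -[i j] _ /=; rewrite (ord1 i).
Qed.

Lemma rV_coord_le (R : realType) m (v : 'rV[R]_m) i : `|v 0 i| <= `|v|.
Proof.
rewrite [leRHS]/Num.Def.normr /= mx_normrE.
exact: (le_bigmax _ (fun ij => `|v ij.1 ij.2|) (0, i)).
Qed.

Lemma is_derive_expRM (R : realType) (c s : R) :
  is_derive s 1 (fun r => expR (c * r)) (c * expR (c * s)).
Proof.
have h : is_derive s 1 (fun r : R => c * r) c.
  by have := is_derive_cmulf c (is_derive_id s (1 : R)); rewrite mulr1.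
have := is_derive1_comp (is_derive_expR (c * s)) h.
by rewrite mulrC.
Qed.

Lemma is_derive_opp_arg (R : realType) (g : R -> R) (s d : R) :
  is_derive (- s) 1 g d -> is_derive s 1 (fun r => g (- r)) (- d).
Proof.
move=> h.
have hN : is_derive s 1 (fun r : R => - r) (-1).
  by apply: is_derive_oppf; apply: is_derive_id.
have := is_derive1_comp h hN.
by rewrite mulrN1.
Qed.

(* In the weighted sup norm sup_t |u t| e^(-c |t|), integration from 0 has
   norm at most 1 / c, so Picard iteration with c = 2 L contracts globally. *)
Lemma is_derive_expR_bound (R : realType) (g dg : R -> R) (c K : R) :
  0 < c -> 0 <= K -> g 0 = 0 ->
  (forall s : R, is_derive s 1 g (dg s)) ->
  (forall s, `|dg s| <= K * expR (c * `|s|)) ->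
  forall t, `|g t| <= K / c * expR (c * `|t|).
Proof.
move=> c0 K0.
have key (f df : R -> R) t : 0 <= t -> f 0 = 0 ->
    (forall s : R, is_derive s 1 f (df s)) ->
    (forall s, `|df s| <= K * expR (c * `|s|)) ->
    f t <= K / c * expR (c * `|t|).
  move=> t0 f0 hf bf; rewrite (ger0_norm t0).
  have hE (s : R) : is_derive s 1 (fun r => K / c * expR (c * r)) (K * expR (c * s)).
    rewrite [X in is_derive _ _ _ X](_ : _ = K / c * (c * expR (c * s))).
      by apply: is_derive_cmulf; apply: is_derive_expRM.
    by field; rewrite gt_eqF.
  have := @is_derive_le R f (fun r => K / c * expR (c * r)) df
    (fun s => K * expR (c * s)) 0 t t0 (fun s _ => hf s) (fun s _ => hE s).
  rewrite f0 subr0 => /(_ _)/le_trans; apply.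
    move=> s /andP[s0 _]; apply: le_trans (ler_norm _) _.
    by have := bf s; rewrite (ger0_norm s0).
  by rewrite gerBl mulr_ge0 ?expR_ge0 // divr_ge0 // ltW.
move=> g0 hg bg.
have key2 (f df : R -> R) t : 0 <= t -> f 0 = 0 ->
    (forall s : R, is_derive s 1 f (df s)) ->
    (forall s, `|df s| <= K * expR (c * `|s|)) ->
    `|f t| <= K / c * expR (c * `|t|).
  move=> t0 f0 hf bf; rewrite ler_norml lerNl; apply/andP; split.
    apply: (key (fun r => - f r) (fun r => - df r)) => //.
    - by rewrite f0 oppr0.
    - by move=> s; rewrite normrN.
  exact: (key f df).
move=> t; have [t0|t0] := leP 0 t; first exact: (key2 g dg).
rewrite -[t]opprK [`|- - t|]normrN.
apply: (key2 (fun r => g (- r)) (fun r => - dg (- r))).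
- by rewrite oppr_ge0 ltW.
- by rewrite oppr0.
- by move=> s; apply: is_derive_opp_arg.
- by move=> s; rewrite normrN -[`|s|]normrN.
Qed.

Lemma geometric_eq0 (R : realType) (x C : R) : 0 <= x ->
  (forall k, x <= C / 2 ^+ k) -> x = 0.
Proof.
move=> x0 h; apply/eqP; rewrite eq_le x0 andbT leNgt; apply/negP => x_gt0.
(* This gives [C / x < 2 ^+ k] at the Archimedean bound [k] of [C / x]. *)
have := upper_nthrootP (leqnn (Num.bound (C / x))).
apply/negP; rewrite -leNgt ler_pdivlMr //.
by have := h (Num.bound (C / x)); rewrite ler_pdivlMr ?exprn_gt0 // mulrC.
Qed.

(** Completeness through monotonicity: with [d k] the tail of the geometric series, [v - d]
    increases, [v + d] decreases and every lower value is below every upper one. The supremum of the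
    lower values is therefore within [d k] of each [v k]. *)
Lemma geometric_limit (R : realType) (v : nat -> R) (C : R) :
  (forall k, `|v k.+1 - v k| <= C / 2 ^+ k) ->
  exists l, forall k, `|v k - l| <= 2 * C / 2 ^+ k.
Proof.
move=> h; pose d k := 2 * C / 2 ^+ k.
have dS k : C / 2 ^+ k = d k - d k.+1.
  by rewrite /d exprS; field; rewrite expf_neq0.
have d_ge0 k : 0 <= d k.
  have := le_trans (normr_ge0 _) (h k).
  by rewrite /d -mulrA; apply: mulr_ge0.
have inc : {homo (fun k => v k - d k) : n p / (n <= p)%N >-> n <= p}.
  apply/nondecreasing_seqP => k; have := h k.
  by rewrite dS ler_norml => /andP[+ _]; lra.
have dec : {homo (fun k => v k + d k) : n p / (n <= p)%N >-> p <= n}.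
  apply/nonincreasing_seqP => k; have := h k.
  by rewrite dS ler_norml => /andP[_]; lra.
have le_lu n p : v n - d n <= v p + d p.
  apply: le_trans (inc n (maxn n p) (leq_maxl _ _)) _.
  apply: le_trans (dec p (maxn n p) (leq_maxr _ _)).
  by have := d_ge0 (maxn n p); lra.
pose l := sup (range (fun k => v k - d k)).
exists l => k; rewrite -/(d k) ler_norml.
have l_ge : v k - d k <= l.
  apply: ub_le_sup; last by exists k.
  by exists (v 0 + d 0) => _ [n _ <-].
have l_le : l <= v k + d k.
  apply: ge_sup; first by exists (v 0 - d 0), 0.
  by move=> _ [n _ <-].
by apply/andP; split; lra.
Qed.

Lemma is_derive_continuous (R : realType) (W : normedModType R) (u : R -> W)
    (s : R) (d : W) :
  is_derive s 1 u d -> {for s, continuous u}.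
Proof.
by move=> [du _]; apply: differentiable_continuous; apply/derivable1_diffP.
Qed.

(** Continuity of [f] is only asked along continuous curves, which is the form that makes the
    integrand of each iterate continuous; the bound at [x0] controls the first step, and the
    Lipschitz constant, uniform in time, all later ones. *)
Lemma picard_global (R : realType) m (f : R -> 'rV[R]_m -> 'rV[R]_m)
    (L M : R) (x0 : 'rV[R]_m) : 0 < L ->
  (forall u : R -> 'rV[R]_m, continuous u -> continuous (fun s => f s (u s))) ->
  (forall s x y, `|f s x - f s y| <= L * `|x - y|) ->
  (forall s, `|f s x0| <= M) ->
  exists u : R -> 'rV[R]_m,
    u 0 = x0 /\ forall s : R, is_derive s 1 u (f s (u s)).
Proof.
move=> L0 cf lipf Mf.
have M0 : 0 <= M := le_trans (normr_ge0 _) (Mf 0).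
have L20 : 0 < 2 * L by lra.
(* [P u] is the Picard iterate of [u]. Choice needs a value at every function, so at a discontinuous
   [u] it is arbitrary. *)
have /choice[P hP] (u : R -> 'rV[R]_m) : exists U : R -> 'rV[R]_m,
    continuous u -> U 0 = x0 /\ forall s : R, is_derive s 1 U (f s (u s)).
  have [cu|ncu] := pselect (continuous u); last by exists u => /ncu.
  have /choice[F hF] (i : 'I_m) : exists F : R -> R,
      F 0 = 0 /\ forall s : R, is_derive s 1 F (f s (u s) 0 i).
    apply: continuous_primitive => s.
    apply: (@continuous_comp _ _ _ (fun r => f r (u r)) (fun v => v 0 i)).
      exact: cf.
    exact: coord_continuous.
  exists (fun s => \row_i (x0 0 i + F i s)) => _; split.
    by apply/rowP => i; rewrite mxE (hF i).1 addr0.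
  move=> s; apply/is_derive_rVP => i.
  rewrite (_ : (fun _ => _) = fun r => cst (x0 0 i) r + F i r); last first.
    by apply/funext => r; rewrite mxE.
  rewrite -[X in is_derive _ _ _ X]add0r.
  by apply: is_derive_addf; apply: (hF i).2.
have cP u : continuous u -> continuous (P u).
  by move=> /hP[_ h] s; apply: is_derive_continuous (h s).
have contr u w K : 0 <= K -> continuous u -> continuous w ->
    (forall s, `|u s - w s| <= K * expR (2 * L * `|s|)) ->
    forall t, `|P u t - P w t| <= K / 2 * expR (2 * L * `|t|).
  move=> K0 /hP[u0 hu] /hP[w0 hw] huw t.
  apply: rV_norm_le => [|i]; first by rewrite mulr_ge0 ?expR_ge0 ?divr_ge0.
  rewrite !mxE (_ : K / 2 = L * K / (2 * L)); last by field; rewrite gt_eqF.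
  apply: (@is_derive_expR_bound _ (fun r => P u r 0 i - P w r 0 i)
    (fun s => f s (u s) 0 i - f s (w s) 0 i)).
  - exact: L20.
  - by rewrite mulr_ge0 // ltW.
  - by rewrite u0 w0 subrr.
  - move=> s; have /is_derive_rVP hus := hu s; have /is_derive_rVP hws := hw s.
    exact: is_derive_subf.
  - move=> s; rewrite -mulrA; apply: le_trans (_ : L * `|u s - w s| <= _).
      apply: le_trans (lipf s _ _).
      by have := rV_coord_le (f s (u s) - f s (w s)) i; rewrite !mxE.
    by rewrite ler_pM2l.
pose U k := iter k P (cst x0).
have cU k : continuous (U k).
  elim: k => [|k IH]; first exact: cst_continuous.
  exact: cP.
pose C := M / (2 * L).
have C0 : 0 <= C by rewrite divr_ge0 // ltW.
have C2k k : 0 <= 2 * C / 2 ^+ k.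
  by apply: divr_ge0; [apply: mulr_ge0 | apply: exprn_ge0].
have stepU k t : `|U k.+1 t - U k t| <= C * expR (2 * L * `|t|) / 2 ^+ k.
  elim: k t => [|k IH] t.
    rewrite expr0 divr1 /=.
    have [h0 h] := hP (cst x0) (cU 0).
    apply: rV_norm_le => [|i]; first by rewrite mulr_ge0 ?expR_ge0.
    rewrite !mxE.
    apply: (@is_derive_expR_bound _ (fun r => P (cst x0) r 0 i - x0 0 i)
      (fun s => f s x0 0 i)).
    - exact: L20.
    - exact: M0.
    - by rewrite h0 subrr.
    - move=> s; have /is_derive_rVP hs := h s.
      have hc := is_derive_cst (x0 0 i : R) s (1 : R).
      by have := is_derive_subf (hs i) hc; rewrite subr0.
    - move=> s; apply: le_trans (rV_coord_le (f s x0) i) _.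
      apply: (le_trans (Mf s)); rewrite ler_peMr // -[leLHS]expR0 ler_expR.
      by rewrite mulr_ge0 // ltW.
  rewrite (_ : _ / _ = C / 2 ^+ k / 2 * expR (2 * L * `|t|)); last first.
    by rewrite exprS; field; rewrite expf_neq0.
  apply: (contr (U k.+1) (U k)) => //.
    by apply: divr_ge0 => //; apply: exprn_ge0.
  by move=> s; rewrite mulrAC.
(* The limit is taken separately at each time and coordinate; the weighted bound [Uu] makes it
   locally uniform afterwards. *)
have /choice[ulim hulim] (ti : R * 'I_m) : exists l, forall k,
    `|U k ti.1 0 ti.2 - l| <= 2 * (C * expR (2 * L * `|ti.1|)) / 2 ^+ k.
  apply: geometric_limit => k; apply: le_trans (stepU k ti.1).
  by have := rV_coord_le (U k.+1 ti.1 - U k ti.1) ti.2; rewrite !mxE.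
pose u t := \row_i ulim (t, i).
have Uu k t : `|U k t - u t| <= 2 * C / 2 ^+ k * expR (2 * L * `|t|).
  apply: rV_norm_le => [|i].
    by rewrite mulr_ge0 ?expR_ge0 // C2k.
  have := hulim (t, i) k; rewrite !mxE /= => /le_trans; apply.
  by rewrite mulrA -mulrAC.
have cu : continuous u.
  move=> t; apply/cvgrPdist_le => e e0.
  pose E := 2 * C * expR (2 * L * (`|t| + 1)).
  have [k hk] : exists k, E / 2 ^+ k <= e / 3.
    exists (Num.bound (E / (e / 3))).
    have := upper_nthrootP (leqnn (Num.bound (E / (e / 3)))).
    set k := Num.bound _ => hk.
    rewrite ler_pdivrMr ?exprn_gt0 // mulrC -ler_pdivrMr ?divr_gt0 //.
    exact: ltW.
  have Ubound s : `|s| <= `|t| + 1 -> `|U k s - u s| <= e / 3.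
    move=> hs; apply: le_trans (Uu k s) _; apply: le_trans hk.
    rewrite /E [leRHS]mulrAC ler_wpM2l //.
    by rewrite ler_expR ler_pM2l.
  have /cvgrPdist_le/(_ (e / 3)) cUk := cU k t.
  have nt : \forall s \near t, `|t - s| <= 1.
    by apply/nbhs_ballP; exists 1 => //= s /ltW.
  near=> s.
  have h1 : `|U k t - u t| <= e / 3 by apply: Ubound; rewrite lerDl.
  have h2 : `|U k s - u s| <= e / 3.
    apply: Ubound; rewrite -lerBlDl.
    apply: le_trans (lerB_dist _ _) _; rewrite distrC.
    by near: s.
  have h3 : `|U k t - U k s| <= e / 3.
    by near: s; apply: cUk; rewrite divr_gt0.
  rewrite (_ : u t - u s = (U k s - u s) - (U k t - u t) + (U k t - U k s)).
    apply: le_trans (ler_normD _ _) _.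
    by have := ler_normB (U k s - u s) (U k t - u t); lra.
  by apply/rowP => i; rewrite !mxE; ring.
have [Pu0 hPu] := hP u cu.
suff Pu : P u = u by exists u; rewrite -{1}Pu; split => // s; rewrite -{1}Pu.
apply/funext => t; apply/eqP; rewrite -subr_eq0 -normr_eq0; apply/eqP.
(* [P u t] and [u t] both lie within [C / 2 ^+ k * expR (2 * L * |t|)] of [U k.+1 t], the former by
   contraction. *)
apply: (@geometric_eq0 _ _ (2 * C * expR (2 * L * `|t|))) => // k.
have h1 := Uu k.+1 t.
have h2 := contr (U k) u _ _ (cU k) cu (Uu k) t.
have {}h2 := h2 (C2k k).
rewrite (_ : P u t - u t = (U k.+1 t - u t) - (P (U k) t - P u t)); last first.
  by apply/rowP => i; rewrite !mxE; ring.
apply: le_trans (ler_normB _ _) _; apply: le_trans (lerD h1 h2) _.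
rewrite le_eqVlt; apply/orP; left; apply/eqP; rewrite exprS.
by field; rewrite expf_neq0.
Unshelve. all: by end_near. Qed.

(** * Gronwall and mean value estimates *)

(** The norm on row vectors is the maximum norm, which need not be differentiable along a curve.
    Sums of squares are, and this inequality carries their estimates back to the norm. *)
Lemma rV_norm_sqr_le (R : realType) m (v : 'rV[R]_m) :
  `|v| ^+ 2 <= \sum_i v 0 i * v 0 i.
Proof.
have S0 : 0 <= \sum_i v 0 i * v 0 i.
  by apply: sumr_ge0 => i _; rewrite -expr2 sqr_ge0.
rewrite -(sqr_sqrtr S0) ler_pXn2r ?nnegrE ?sqrtr_ge0 //.
apply: rV_norm_le => [|i]; first exact: sqrtr_ge0.
rewrite -sqrtr_sqr ler_wsqrtr // expr2 (bigD1 i) //= lerDl.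
by apply: sumr_ge0 => j _; rewrite -expr2 sqr_ge0.
Qed.

(** The sum of squares phi of r satisfies phi' <= c phi + N eta^2, because 2 |r| (L |r| + eta) <= (2
    L + 1) |r|^2 + eta^2; weighting by e^(-c s) and integrating bounds phi. [C] is fixed before the
    curve, so one constant serves all neighbouring curves. *)
Lemma gronwall (R : realType) m (L t : R) : 0 <= L -> 0 <= t ->
  exists C, 0 < C /\ forall (r dr : R -> 'rV[R]_m) (eta : R), 0 <= eta ->
    (forall s : R, 0 <= s <= t -> is_derive s 1 r (dr s)) ->
    (forall s, 0 <= s <= t -> `|dr s| <= L * `|r s| + eta) ->
    forall s, 0 <= s <= t -> `|r s| <= C * (`|r 0| + eta).
Proof.
move=> L0 t0; pose N : R := m%:R; pose c := N * (2 * L + 1).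
have N0 : 0 <= N by exact: ler0n.
have c0 : 0 <= c by rewrite mulr_ge0 //; lra.
pose A := expR (c * t) * (N * (1 + t)).
have A0 : 0 <= A by rewrite !mulr_ge0 ?expR_ge0 //; lra.
(* The argument gives phi <= A (|r 0| + eta)^2; the inequality A <= (1 + A)^2 replaces taking the
   root of [A]. *)
exists (1 + A); split; first lra.
move=> r dr eta eta0 hr hdr s /andP[s0 st].
have sum_le (F : 'I_m -> R) b : (forall i, F i <= b) -> \sum_i F i <= N * b.
  move=> h; apply: le_trans (ler_sum _ (fun i _ => h i)) _.
  by rewrite sumr_const card_ord -mulr_natl.
pose phi s := \sum_i r s 0 i * r s 0 i.
pose dphi s := \sum_i (r s 0 i * dr s 0 i + r s 0 i * dr s 0 i).
have hphi x : 0 <= x <= t -> is_derive x 1 phi (dphi x).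
  move=> xt; apply: is_derive_sumf => i.
  have /is_derive_rVP/(_ i) h := hr x xt.
  exact: is_derive_mulf.
have dphi_le x : 0 <= x <= t -> dphi x <= c * phi x + N * eta ^+ 2.
  move=> xt; apply: le_trans (_ : N * (2 * (`|r x| * (L * `|r x| + eta))) <= _).
    apply: sum_le => i; rewrite -mulr2n -[leLHS]mulr_natl ler_pM2l //.
    apply: le_trans (ler_norm _) _; rewrite normrM ler_pM //.
      exact: rV_coord_le.
    exact: le_trans (rV_coord_le _ _) (hdr x xt).
  rewrite /c -mulrA -mulrDr ler_wpM2l //.
  have h1 := rV_norm_sqr_le (r x); rewrite -/(phi x) in h1.
  have h2 : (2 * L + 1) * `|r x| ^+ 2 <= (2 * L + 1) * phi x.
    by rewrite ler_wpM2l //; lra.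
  apply: le_trans (lerD h2 (lexx (eta ^+ 2))).
  by have := sqr_ge0 (`|r x| - eta); rewrite !expr2; nra.
pose psi x := expR (- c * x) * phi x.
have hpsi x : 0 <= x <= t -> is_derive x 1 psi
    (expR (- c * x) * dphi x + phi x * (- c * expR (- c * x))).
  move=> xt; apply: is_derive_mulf; first exact: is_derive_expRM.
  exact: hphi.
have hlin (x : R) : is_derive x 1 (fun y => N * eta ^+ 2 * y) (N * eta ^+ 2).
  by have := is_derive_cmulf (N * eta ^+ 2) (is_derive_id x (1 : R));
    rewrite mulr1.
have sub x : 0 <= x <= s -> 0 <= x <= t.
  by move=> /andP[-> /le_trans]; apply.
have := is_derive_le s0 (fun x h => hpsi x (sub x h)) (fun x _ => hlin x).
rewrite mulr0 subr0 /psi mulr0 expR0 mul1r => /(_ _) psi_le.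
have {}psi_le : expR (- c * s) * phi s - phi 0 <= N * eta ^+ 2 * s.
  apply: psi_le => x xs; have := dphi_le x (sub x xs) => h.
  apply: le_trans (_ : expR (- c * x) * (N * eta ^+ 2) <= _).
    rewrite (_ : _ + _ = expR (- c * x) * (dphi x - c * phi x)); last by ring.
    by rewrite ler_wpM2l ?expR_ge0 //; lra.
  rewrite -[leRHS]mul1r ler_wpM2r ?mulr_ge0 ?sqr_ge0 //.
  rewrite -expR0 ler_expR mulNr oppr_le0 mulr_ge0 //.
  by case/andP: xs.
have phi0 : phi 0 <= N * `|r 0| ^+ 2.
  apply: sum_le => i; apply: le_trans (ler_norm _) _.
  by rewrite normrM expr2 ler_pM ?rV_coord_le.
have phis : phi s = expR (c * s) * (expR (- c * s) * phi s).
  by rewrite mulrA -expRD mulNr subrr expR0 mul1r.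
have le_phi : phi s <= A * (`|r 0| + eta) ^+ 2.
  rewrite phis /A -[leRHS]mulrA ler_pM ?expR_ge0 //.
  - by rewrite mulr_ge0 ?expR_ge0 // sumr_ge0 // => i _; rewrite -expr2 sqr_ge0.
  - by rewrite ler_expR ler_wpM2l.
  apply: le_trans (_ : N * (`|r 0| ^+ 2 + eta ^+ 2 * t) <= _).
    have : N * eta ^+ 2 * s <= N * eta ^+ 2 * t.
      by rewrite ler_wpM2l // mulr_ge0 ?sqr_ge0.
    lra.
  rewrite -mulrA ler_wpM2l //.
  have := normr_ge0 (r 0); move: `|r 0| => q q0.
  have h1 : 0 <= q * eta by rewrite mulr_ge0.
  have h2 : 0 <= q * eta * t by rewrite mulr_ge0.
  have h3 : 0 <= q ^+ 2 * t by rewrite mulr_ge0 ?sqr_ge0.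
  have h4 := sqr_ge0 eta.
  by rewrite (_ : (1 + t) * _ = q ^+ 2 + eta ^+ 2 * t + (2 * (q * eta) +
    2 * (q * eta * t) + q ^+ 2 * t + eta ^+ 2)); [lra | ring].
have q0 : 0 <= `|r 0| + eta by rewrite addr_ge0.
rewrite -(@ler_pXn2r _ 2) ?nnegrE ?mulr_ge0 //; last lra.
apply: le_trans (rV_norm_sqr_le _) _; apply: (le_trans le_phi).
rewrite exprMn ler_wpM2r ?sqr_ge0 //.
by rewrite expr2; nra.
Qed.

(** Coordinates are moved one at a time, so the one-variable mean value theorem can be applied with
    partial derivatives alone. Each [xi j] lies in the box spanned by [x] and [x + k]. *)
Lemma mean_value_coords (R : realType) m (f : 'rV[R]_m -> R) :
  (forall j x, derivable f x (delta_mx 0 j)) ->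
  forall x k : 'rV[R]_m, exists xi : 'I_m -> 'rV[R]_m,
    (forall j i, exists2 th, 0 <= th <= 1 & xi j 0 i = x 0 i + th * k 0 i) /\
    f (x + k) - f x = \sum_j k 0 j * 'D_(delta_mx 0 j) f (xi j).
Proof.
move=> df x k.
(* In [y p] the coordinates of index below [p] have already moved, so [y 0] is [x] and [y m] is
   [x + k]. *)
pose y p : 'rV[R]_m := \row_i (x 0 i + (i < p)%:R * k 0 i).
have yS (j : 'I_m) : y j.+1 = y j + k 0 j *: delta_mx 0 j.
  apply/rowP => i; rewrite !mxE eqxx ltnS leq_eqVlt val_eqE /=.
  have [->|_] := eqVneq i j; last by rewrite /= mulr0 addr0.
  by rewrite ltnn !mul1r !mul0r mulr1 addr0.
have mv (j : 'I_m) : exists th, 0 <= th <= 1 /\ f (y j.+1) - f (y j) =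
    k 0 j * 'D_(delta_mx 0 j) f (y j + (th * k 0 j) *: delta_mx 0 j).
  pose g (s : R) := f (y j + (s * k 0 j) *: delta_mx 0 j).
  have dg (s : R) : is_derive s 1 g
      (k 0 j * 'D_(delta_mx 0 j) f (y j + (s * k 0 j) *: delta_mx 0 j)).
    set z := y j + _.
    have hz : is_derive (s * k 0 j) 1
        (fun a : R => f (y j + a *: delta_mx 0 j)) ('D_(delta_mx 0 j) f z).
      have E : (fun h : R => h^-1 *: (((fun a : R => f (y j + a *: delta_mx 0 j))
            \o shift (s * k 0 j)) (h *: (1 : R)) - f z)) =
          (fun h : R => h^-1 *: ((f \o shift z) (h *: delta_mx 0 j) - f z)).
        apply/funext => h /=.
        by rewrite [h *: (1 : R)]mulr1 scalerDl /z addrCA.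
      split; first by rewrite /derivable E; exact: (df j z).
      by rewrite /derive E.
    have hk : is_derive s 1 (fun s : R => s * k 0 j) (k 0 j).
      have := is_derive_cmulf (k 0 j) (is_derive_id s (1 : R)).
      by rewrite mulr1; under eq_fun do rewrite mulrC.
    by have := @is_derive1_comp _ (fun a : R => f (y j + a *: delta_mx 0 j))
      (fun s : R => s * k 0 j) s _ _ hz hk; rewrite mulrC.
  have [th th01 e] := @MVT_segment R g _ 0 1 ler01 (fun s _ => dg s)
    (derivable_within_continuous (fun s _ => ex_derive (is_derive := dg s))).
  exists th; split; first by move: th01; rewrite in_itv.
  move: e; rewrite subr0 mulr1 /g mul1r mul0r scale0r addr0 -yS => ->.
  by [].
have {mv}/choice[th hth] := mv.
exists (fun j : 'I_m => y j + (th j * k 0 j) *: delta_mx 0 j); split.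
  move=> j i; have [th01 _] := hth j.
  rewrite !mxE eqxx /=; have [->|ij] := eqVneq i j.
    by exists (th j) => //; rewrite ltnn mul0r addr0 mulr1.
  exists (i < j)%:R; last by rewrite mulr0 addr0.
  by case: (i < j)%N; rewrite ?lexx ler01.
rewrite -(eq_bigr _ (fun j _ => (hth j).2)).
rewrite -(big_mkord predT (fun j => f (y j.+1) - f (y j))) telescope_sumr //.
congr (f _ - f _); apply/rowP => i; rewrite !mxE.
  by rewrite ltn_ord mul1r.
by rewrite mul0r addr0.
Qed.

Lemma compact_box (R : realType) m (B : R) :
  compact [set x : 'rV[R]_m | `|x| <= B].
Proof.
apply: bounded_closed_compact.
  exists B; split; first exact: num_real.
  by move=> M ltBM x /= /le_trans; apply; exact: ltW.
apply: (@closed_comp _ _ (fun x : 'rV[R]_m => `|x|) [set r | r <= B]).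
  by move=> x _; exact: norm_continuous.
exact: closed_le.
Qed.

Lemma continuous_box_bounded (R : realType) m (g : 'rV[R]_m -> R) (B : R) :
  continuous g -> exists M, 0 < M /\ forall x, `|x| <= B -> `|g x| <= M.
Proof.
move=> cg; have cB := @compact_box R m B.
have : bounded_set (g @` [set x : 'rV[R]_m | `|x| <= B]).
  by apply: compact_bounded; apply: continuous_compact => //;
    exact: continuous_subspaceT.
move=> [M [_ hM]]; exists (`|M| + 1); split; first by rewrite ltr_wpDl.
move=> x xB; apply: (hM (`|M| + 1)); last by exists x.
by rewrite (le_lt_trans (ler_norm M)) // ltrDl.
Qed.

(** Uniform continuity from the covering form of compactness, with the radius [d] as the parameter
    tending to 0. Only [x] is confined to the box; [x + k] may leave it. *)
Lemma continuous_box_modulus (R : realType) m (g : 'rV[R]_m -> R) (B e : R) :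
  continuous g -> 0 < e -> exists d, 0 < d /\
    forall x k, `|x| <= B -> `|k| <= d -> `|g (x + k) - g x| <= e.
Proof.
move=> cg e0; have cB := @compact_box R m B.
move/compact_near_coveringP : cB => /(_ R (0 : R)^'+
  (fun d x => forall k, `|k| <= d -> `|g (x + k) - g x| <= e) _).
case.
  move=> x _; have /cvgrPdist_le/(_ (e / 2)) := cg x.
  rewrite divr_gt0 // => /(_ isT)/nbhs_ballP[r /= r0 hr].
  (* Half radii keep both [x'] and [x' + k] within [r] of [x]. *)
  exists (ball x (r / 2), [set d | d < r / 2]).
    split; first by apply: nbhsx_ballx; rewrite divr_gt0.
    by apply: nbhs_right_lt; rewrite divr_gt0.
  move=> [x' d] /= [xx' dr] k kd.
  rewrite -ball_normE /= in xx'.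
  have h1 : `|g x - g x'| <= e / 2.
    by apply: hr; rewrite -ball_normE /=; lra.
  have h2 : `|g x - g (x' + k)| <= e / 2.
    apply: hr; rewrite -ball_normE /= opprD addrA.
    by apply: le_lt_trans (ler_normB _ _) _; lra.
  rewrite (_ : _ - _ = (g x - g x') - (g x - g (x' + k))); last by ring.
  by apply: le_trans (ler_normB _ _) _; lra.
move=> d /= d0 hd; exists (d / 2); split; first by rewrite divr_gt0.
move=> x k xB; apply: hd => //=; last by rewrite divr_gt0.
by rewrite sub0r normrN gtr0_norm ?divr_gt0 //; lra.
Qed.

(** Phrased through coordinate derivatives because [C2] is; total differentiability enters through
    the uniform Taylor bounds on boxes. *)
Definition C1_fun (R : realType) m (f : 'rV[R]_m -> R) : Prop :=
  (forall j x, derivable f x (delta_mx 0 j)) /\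
  (forall j, continuous (fun x => 'D_(delta_mx 0 j) f x)).

Section C1_fun_box.
Variables (R : realType) (m : nat).
Implicit Types (f : 'rV[R]_m -> R) (x k : 'rV[R]_m) (B : R).

Let between_norm (x k z : 'rV[R]_m) : (forall i,
    exists2 th, 0 <= th <= 1 & z 0 i = x 0 i + th * k 0 i) ->
  (forall B, `|x| <= B -> `|x + k| <= B -> `|z| <= B) /\ `|z - x| <= `|k|.
Proof.
move=> h; split=> [B xB xkB|].
  apply: rV_norm_le => [|i]; first exact: le_trans xB.
  have [th /andP[th0 th1] ->] := h i.
  have hx := le_trans (rV_coord_le x i) xB.
  have hxk := le_trans (rV_coord_le (x + k) i) xkB.
  rewrite mxE in hxk.
  rewrite (_ : _ + _ = (1 - th) * x 0 i + th * (x 0 i + k 0 i)); last by ring.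
  rewrite (_ : B = (1 - th) * B + th * B); last by ring.
  apply: le_trans (ler_normD _ _) _; rewrite !normrM.
  have th1' : 0 <= 1 - th by lra.
  by rewrite (ger0_norm th0) (ger0_norm th1') lerD // ler_wpM2l.
apply: rV_norm_le => // i; have [th /andP[th0 th1] e] := h i.
rewrite !mxE e addrAC subrr add0r normrM (ger0_norm th0).
by apply: le_trans (rV_coord_le k i); rewrite ler_piMl.
Qed.

Let sum_norm_le (F : 'I_m -> R) k b : (forall j, `|F j| <= b) ->
  `|\sum_j k 0 j * F j| <= m%:R * b * `|k|.
Proof.
move=> h; apply: le_trans (ler_norm_sum _ _ _) _.
apply: le_trans (ler_sum _ (_ : forall j, true -> _ <= b * `|k|)) _.
  move=> j _; rewrite normrM mulrC ler_pM // rV_coord_le //.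
by rewrite sumr_const card_ord -mulrA mulr_natl.
Qed.

Lemma deriv_box_bounded f B : C1_fun f ->
  exists M, 0 < M /\ forall j x, `|x| <= B -> `|'D_(delta_mx 0 j) f x| <= M.
Proof.
move=> [_ cf].
have /choice[M hM] (j : 'I_m) := @continuous_box_bounded _ _ _ B (cf j).
exists (1 + \sum_j M j); split.
  by rewrite ltr_pwDl // sumr_ge0 // => j _; exact/ltW/(hM j).1.
move=> j x /(hM j).2 /le_trans; apply.
rewrite (bigD1 j) //= addrCA lerDl addr_ge0 // sumr_ge0 // => i _.
exact/ltW/(hM i).1.
Qed.

Lemma C1_box_lipschitz f B : C1_fun f ->
  exists L, 0 < L /\ forall x y, `|x| <= B -> `|y| <= B ->
    `|f x - f y| <= L * `|x - y|.
Proof.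
move=> Cf; have [M [M0 hM]] := deriv_box_bounded B Cf.
exists (m%:R * M + 1); split; first by rewrite ltr_wpDl // mulr_ge0 // ltW.
move=> x y xB yB; have [xi [h e]] := mean_value_coords Cf.1 y (x - y).
rewrite [y + _]addrC subrK in e; rewrite e.
apply: le_trans (sum_norm_le (b := M) _ _) _.
  move=> j; apply: hM; apply: (between_norm (h j)).1 => //.
  by rewrite addrC subrK.
by rewrite ler_wpM2r // lerDl.
Qed.

Lemma C1_box_taylor f B e : C1_fun f -> 0 < e ->
  exists d, 0 < d /\ forall x k, `|x| <= B -> `|k| <= d ->
    `|f (x + k) - f x - \sum_j k 0 j * 'D_(delta_mx 0 j) f x| <= e * `|k|.
Proof.
move=> Cf e0.
(* The error is summed over [m] coordinates; the added 1 keeps the denominator positive when [m] is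
   0. *)
pose e' := e / (m%:R + 1).
have e'0 : 0 < e' by rewrite divr_gt0 // ltr_wpDl.
have /choice[d hd] (j : 'I_m) := @continuous_box_modulus _ _ _ B e' (Cf.2 j) e'0.
exists (\big[Num.min/1]_j d j); split.
  by apply: lt_bigmin => // j _; exact: (hd j).1.
move=> x k xB kd; have [xi [h ->]] := mean_value_coords Cf.1 x k.
rewrite -sumrB; under eq_bigr do rewrite -mulrBr.
apply: le_trans (sum_norm_le (b := e') _ _) _.
  move=> j; have := (hd j).2 x (xi j - x) xB; rewrite [x + _]addrC subrK.
  apply; apply: le_trans (between_norm (h j)).2 _.
  by apply: le_trans kd _; exact: bigmin_le_cond.
rewrite ler_wpM2r // /e' mulrA ler_pdivrMr ?ltr_wpDl //.
by rewrite mulrC ler_wpM2l ?ltW // ltrDl.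
Qed.

(** Lipschitz partial derivatives make the remainder quadratic, which the action estimate requires.
    Both ends lie in the box so that the intermediate points do as well. *)
Lemma C2_box_taylor f B : C1_fun f ->
  (forall j, C1_fun (fun x => 'D_(delta_mx 0 j) f x)) ->
  exists C, 0 < C /\ forall x k, `|x| <= B -> `|x + k| <= B ->
    `|f (x + k) - f x - \sum_j k 0 j * 'D_(delta_mx 0 j) f x| <= C * `|k| ^+ 2.
Proof.
move=> Cf C2f.
have /choice[L hL] (j : 'I_m) := C1_box_lipschitz B (C2f j).
pose M := \sum_j L j.
have leM j : L j <= M.
  rewrite /M (bigD1 j) //= lerDl sumr_ge0 // => i _.
  exact/ltW/(hL i).1.
have M0 : 0 <= M by apply: sumr_ge0 => i _; exact/ltW/(hL i).1.
exists (m%:R * M + 1); split; first by rewrite ltr_wpDl // mulr_ge0.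
move=> x k xB kB; have [xi [h ->]] := mean_value_coords Cf.1 x k.
rewrite -sumrB; under eq_bigr do rewrite -mulrBr.
apply: le_trans (sum_norm_le (b := M * `|k|) _ _) _.
  move=> j; have [xiB xik] := between_norm (h j).
  apply: le_trans ((hL j).2 _ _ (xiB B xB kB) xB) _.
  by rewrite ler_pM // ltW // (hL j).1.
by rewrite mulrA -mulrA -expr2 ler_wpM2r ?sqr_ge0 // lerDl.
Qed.

End C1_fun_box.

(** * Flows of continuously differentiable vector fields *)

Definition C1_field (R : realType) m (F : 'rV[R]_m -> 'rV[R]_m) : Prop :=
  forall i, C1_fun (fun x => F x 0 i).

Definition field_deriv (R : realType) m (F : 'rV[R]_m -> 'rV[R]_m)
    (x w : 'rV[R]_m) : 'rV[R]_m :=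
  \row_i \sum_j w 0 j * 'D_(delta_mx 0 j) (fun y => F y 0 i) x.

Definition integral_curve (R : realType) m (F : 'rV[R]_m -> 'rV[R]_m)
    (g : R -> 'rV[R]_m) (a b : R) : Prop :=
  forall s : R, a < s < b -> is_derive s 1 g (F (g s)).

Section vector_field.
Variables (R : realType) (m : nat) (F : 'rV[R]_m -> 'rV[R]_m).
Hypothesis F_C1 : C1_field F.
Implicit Types (x y w k v : 'rV[R]_m) (g : R -> 'rV[R]_m) (B L a b e t : R).

Let uniform_bound (P : 'I_m -> R -> Prop) :
  (forall i L M, L <= M -> P i L -> P i M) ->
  (forall i, exists L, 0 < L /\ P i L) ->
  exists L, 0 < L /\ forall i, P i L.
Proof.
move=> mono /choice[L hL]; exists (1 + \sum_i L i); split.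
  by rewrite ltr_pwDl // sumr_ge0 // => j _; exact/ltW/(hL j).1.
move=> i; apply: mono (hL i).2; rewrite (bigD1 i) //= addrCA lerDl.
by rewrite addr_ge0 // sumr_ge0 // => j _; exact/ltW/(hL j).1.
Qed.

Lemma field_box_lipschitz B : exists L, 0 < L /\
  forall x y, `|x| <= B -> `|y| <= B -> `|F x - F y| <= L * `|x - y|.
Proof.
have [||L [L0 hL]] := @uniform_bound (fun i L => forall x y, `|x| <= B ->
  `|y| <= B -> `|F x 0 i - F y 0 i| <= L * `|x - y|).
- move=> i L M LM h x y xB yB; apply: le_trans (h x y xB yB) _.
  exact: ler_wpM2r.
- by move=> i; exact: (C1_box_lipschitz B (F_C1 i)).
exists L; split => // x y xB yB; apply: rV_norm_le => [|i].
  by rewrite mulr_ge0 // ltW.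
by rewrite !mxE; apply: hL.
Qed.

Lemma field_deriv_box_bounded B : exists L, 0 < L /\
  forall x w, `|x| <= B -> `|field_deriv F x w| <= L * `|w|.
Proof.
have [||L [L0 hL]] := @uniform_bound (fun i L => forall j x, `|x| <= B ->
  `|'D_(delta_mx 0 j) (fun y => F y 0 i) x| <= L).
- by move=> i L M LM h j x xB; apply: le_trans (h j x xB) _.
- by move=> i; exact: (deriv_box_bounded B (F_C1 i)).
exists (m%:R * L + 1); split; first by rewrite ltr_wpDl // mulr_ge0 // ltW.
move=> x w xB; apply: rV_norm_le => [|i].
  by rewrite mulr_ge0 // addr_ge0 // mulr_ge0 // ltW.
rewrite mxE; apply: le_trans (ler_norm_sum _ _ _) _.
apply: le_trans (ler_sum _ (_ : forall j, true -> _ <= L * `|w|)) _.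
  by move=> j _; rewrite normrM mulrC ler_pM // ?hL // rV_coord_le.
rewrite sumr_const card_ord -[leLHS]mulr_natl mulrA.
by rewrite ler_wpM2r // lerDl.
Qed.

Lemma field_box_taylor B e : 0 < e -> exists d, 0 < d /\
  forall x k, `|x| <= B -> `|k| <= d ->
    `|F (x + k) - F x - field_deriv F x k| <= e * `|k|.
Proof.
move=> e0.
have /choice[d hd] (i : 'I_m) := C1_box_taylor B (F_C1 i) e0.
exists (\big[Num.min/1]_j d j); split.
  by apply: lt_bigmin => // j _; exact: (hd j).1.
move=> x k xB kd; apply: rV_norm_le => [|i]; first by rewrite mulr_ge0 // ltW.
rewrite !mxE; apply: (hd i).2 => //.
by apply: le_trans kd _; exact: bigmin_le_cond.
Qed.

Lemma field_derivB x v w : field_deriv F x v - field_deriv F x w =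
  field_deriv F x (v - w).
Proof.
apply/rowP => i; rewrite !mxE -sumrB; apply: eq_bigr => j _.
by rewrite !mxE mulrBl.
Qed.

Lemma path_bounded g a b :
  (forall s, a <= s <= b -> {for s, continuous g}) ->
  exists B, 0 < B /\ forall s, a <= s <= b -> `|g s| <= B.
Proof.
move=> cg.
have : bounded_set (g @` [set` `[a, b]]).
  apply: compact_bounded; apply: continuous_compact; last exact: segment_compact.
  apply: continuous_in_subspaceT => s; rewrite inE /= in_itv /=; exact: cg.
move=> [M [_ hM]]; exists (`|M| + 1); split; first by rewrite ltr_wpDl.
move=> s sab; apply: (hM (`|M| + 1)); last by exists s; rewrite //= in_itv.
by rewrite (le_lt_trans (ler_norm M)) // ltrDl.
Qed.

Lemma integral_curve_continuous g a b s : integral_curve F g a b -> a < s < b ->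
  {for s, continuous g}.
Proof. by move=> h /h; exact: is_derive_continuous. Qed.

Lemma is_derive_rV_sub (g1 g2 : R -> 'rV[R]_m) (s : R) (d1 d2 : 'rV[R]_m) :
  is_derive s 1 g1 d1 -> is_derive s 1 g2 d2 ->
  is_derive s 1 (fun r => g1 r - g2 r) (d1 - d2).
Proof. exact: is_deriveB. Qed.

(** Compactness of the time segment puts both curves into one box, where [F] is Lipschitz; Gronwall
    for their difference has zero initial value and zero defect. *)
Lemma integral_curve_unique g1 g2 e1 e2 t : 0 <= t -> 0 < e1 -> 0 < e2 ->
  integral_curve F g1 (- e1) (t + e1) -> integral_curve F g2 (- e2) (t + e2) ->
  g1 0 = g2 0 -> forall s, 0 <= s <= t -> g1 s = g2 s.
Proof.
move=> t0 e10 e20 h1 h2 g0.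
have in1 s : 0 <= s <= t -> - e1 < s < t + e1 by move=> /andP[? ?]; lra.
have in2 s : 0 <= s <= t -> - e2 < s < t + e2 by move=> /andP[? ?]; lra.
have [B1 [B10 hB1]] := @path_bounded g1 0 t
  (fun s st => integral_curve_continuous h1 (in1 s st)).
have [B2 [B20 hB2]] := @path_bounded g2 0 t
  (fun s st => integral_curve_continuous h2 (in2 s st)).
have [L [L0 hL]] := field_box_lipschitz (B1 + B2).
have [C [C0 hC]] := @gronwall R m L t (ltW L0) t0.
move=> s st; apply/eqP; rewrite -subr_eq0 -normr_le0.
have := hC (fun s => g1 s - g2 s) (fun s => F (g1 s) - F (g2 s)) 0 (lexx _)
  _ _ s st.
rewrite g0 subrr normr0 addr0 mulr0; apply.
  move=> r rt; apply: is_derive_rV_sub; first exact: (h1 _ (in1 _ rt)).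
  exact: (h2 _ (in2 _ rt)).
move=> r rt; rewrite addr0; apply: hL.
  by apply: le_trans (hB1 r rt) _; rewrite lerDl ltW.
by apply: le_trans (hB2 r rt) _; rewrite lerDr ltW.
Qed.

End vector_field.

(** Clamping serves twice: in time it extends a curve on a segment to a bounded curve on the whole
    line, and coordinatewise in space it retracts onto a box without increasing distances. *)
Definition clamp (R : realType) (a b s : R) : R := Num.max a (Num.min b s).

Lemma clamp_id (R : realType) (a b s : R) : a <= s <= b -> clamp a b s = s.
Proof. by move=> /andP[as_ sb]; rewrite /clamp (min_idPr sb) (max_idPr as_). Qed.

Lemma clamp_itv (R : realType) (a b s : R) : a <= b -> a <= clamp a b s <= b.
Proof. by move=> ab; rewrite /clamp le_max lexx ge_max ab ge_min lexx. Qed.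

Lemma clamp_lipschitz (R : realType) (a b s r : R) :
  `|clamp a b s - clamp a b r| <= `|s - r|.
Proof.
rewrite /clamp /Num.max /Num.min.
have [?|?] := ltP b s; have [?|?] := ltP b r; have [?|?] := ltP a b;
  have [?|?] := ltP a s; have [?|?] := ltP a r;
  rewrite ler_norml; apply/andP; split;
  have := ler_norm (s - r); have := ler_norm (- (s - r)); rewrite normrN;
  have := normr_ge0 (s - r); lra.
Qed.

Definition clamp_rV (R : realType) m (B : R) (x : 'rV[R]_m) : 'rV[R]_m :=
  \row_i clamp (- B) B (x 0 i).

Lemma clamp_rV_norm (R : realType) m (B : R) (x : 'rV[R]_m) : 0 <= B ->
  `|clamp_rV B x| <= B.
Proof.
move=> B0; apply: rV_norm_le => // i.
by rewrite mxE ler_norml clamp_itv //; lra.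
Qed.

Lemma clamp_rV_id (R : realType) m (B : R) (x : 'rV[R]_m) : `|x| <= B ->
  clamp_rV B x = x.
Proof.
move=> xB; apply/rowP => i; rewrite mxE clamp_id // -ler_norml.
exact: le_trans (rV_coord_le x i) xB.
Qed.

Lemma clamp_rV_lipschitz (R : realType) m (B : R) (x z : 'rV[R]_m) :
  `|clamp_rV B x - clamp_rV B z| <= `|x - z|.
Proof.
apply: rV_norm_le => // i; rewrite !mxE.
apply: le_trans (clamp_lipschitz _ _ _ _) _.
by have := rV_coord_le (x - z) i; rewrite !mxE.
Qed.

Lemma lipschitz_continuous (R : realType) (V W : normedModType R) (f : V -> W)
    (L : R) : 0 < L ->
  (forall x y, `|f x - f y| <= L * `|x - y|) -> continuous f.
Proof.
move=> L0 h x; apply/cvgrPdist_le => e e0.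
apply/nbhs_ballP; exists (e / L) => /=; first by rewrite divr_gt0.
move=> y; rewrite -ball_normE /= => xy; apply: le_trans (h x y) _.
by rewrite mulrC -ler_pdivlMr // ltW.
Qed.

(** The clamped field is globally Lipschitz, so its solution exists for all times; it is an integral
    curve of [F] as long as it stays in the box. *)
Lemma clamped_global_curve (R : realType) m (F : 'rV[R]_m -> 'rV[R]_m)
    (B : R) (y : 'rV[R]_m) : C1_field F -> 0 <= B ->
  exists u : R -> 'rV[R]_m, u 0 = y /\ forall s : R,
    is_derive s 1 u (F (clamp_rV B (u s))).
Proof.
move=> F_C1 B0; have [L [L0 hL]] := field_box_lipschitz F_C1 B.
have lipF x z : `|F (clamp_rV B x) - F (clamp_rV B z)| <= L * `|x - z|.
  apply: le_trans (hL _ _ (clamp_rV_norm x B0) (clamp_rV_norm z B0)) _.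
  by rewrite ler_pM2l // clamp_rV_lipschitz.
have cF : continuous (F \o clamp_rV B) := lipschitz_continuous L0 lipF.
apply: (@picard_global R m (fun _ x => F (clamp_rV B x)) L
  `|F (clamp_rV B y)| y L0) => //.
move=> v cv s; exact: (continuous_comp (cv s) (cF (v s))).
Qed.

Lemma linear_global_curve (R : realType) m (F : 'rV[R]_m -> 'rV[R]_m)
    (g : R -> 'rV[R]_m) (w : 'rV[R]_m) (B : R) : C1_field F -> continuous g ->
  (forall s, `|g s| <= B) ->
  exists u : R -> 'rV[R]_m, u 0 = w /\ forall s : R,
    is_derive s 1 u (field_deriv F (g s) (u s)).
Proof.
move=> F_C1 cg gB; have [L [L0 hL]] := field_deriv_box_bounded F_C1 B.
apply: (@picard_global R m (fun s x => field_deriv F (g s) x) L (L * `|w|) w L0).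
- move=> u cu s; apply/cvgrPdist_le => e e0.
  near=> r; apply: rV_norm_le => [|i]; first exact: ltW.
  rewrite [X in `|X|](_ : _ = field_deriv F (g s) (u s) 0 i -
    field_deriv F (g r) (u r) 0 i); last by rewrite !mxE.
  move: i; near: r; apply: filter_forall => i.
  have : field_deriv F (g r) (u r) 0 i @[r --> s] -->
      field_deriv F (g s) (u s) 0 i.
    rewrite [X in X @ _](_ : _ = fun r => \sum_j u r 0 j *
      'D_(delta_mx 0 j) (fun y => F y 0 i) (g r)); last first.
      by apply/funext => r; rewrite mxE.
    rewrite mxE; apply: cvg_big => [|j _]; first exact: add_continuous.
    apply: cvgM.
      exact: (continuous_comp (cu s) (@coord_continuous _ _ _ 0 j (u s))).
    exact: (continuous_comp (cg s) ((F_C1 i).2 j (g s))).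
  by move/cvgrPdist_le/(_ e e0).
- by move=> s x y; rewrite field_derivB; apply: hL.
- by move=> s; apply: hL.
Unshelve. all: by end_near. Qed.

Lemma is_derive_mulmx_l (R : realType) m (W dW : R -> 'M[R]_m) (v : 'rV[R]_m)
    (s : R) :
  (forall i, is_derive s 1 (fun r => row i (W r)) (row i (dW s))) ->
  is_derive s 1 (fun r => v *m W r) (v *m dW s).
Proof.
move=> h; apply/is_derive_rVP => j; rewrite mxE.
rewrite (_ : (fun _ => _) = fun r => \sum_i v 0 i * W r i j); last first.
  by apply/funext => r; rewrite mxE.
apply: is_derive_sumf => i; apply: is_derive_cmulf.
have /is_derive_rVP/(_ j) := h i; rewrite mxE.
by under eq_fun do rewrite mxE.
Qed.

Lemma field_deriv_mulmx (R : realType) m (F : 'rV[R]_m -> 'rV[R]_m)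
    (x v : 'rV[R]_m) (W : 'M[R]_m) :
  field_deriv F x (v *m W) = v *m \matrix_(i < m) field_deriv F x (row i W).
Proof.
apply/rowP => k; rewrite !mxE.
under eq_bigr do rewrite mxE mulr_suml.
rewrite exchange_big /=; apply: eq_bigr => i _; rewrite !mxE mulr_sumr.
by apply: eq_bigr => j _; rewrite !mxE mulrA.
Qed.

Section nearby.
Variables (R : realType) (m : nat) (F : 'rV[R]_m -> 'rV[R]_m).
Hypothesis F_C1 : C1_field F.
Variables (g : R -> 'rV[R]_m) (t e : R).

(** The curves [u y] solve the field clamped to a box one unit larger than a bound for [g]. Gronwall
    for the clamped field keeps them within 1 of [g], hence inside the box, where clamping does
    nothing: they are true integral curves. *)
Lemma nearby_curves : 0 <= t -> 0 < e -> integral_curve F g (- e) (t + e) ->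
  exists (B C d : R) (u : 'rV[R]_m -> R -> 'rV[R]_m),
  [/\ 0 < C, 0 < d, forall s, 0 <= s <= t -> `|g s| <= B &
  forall y, `|y - g 0| <= d ->
    [/\ u y 0 = y,
        exists2 e', 0 < e' & integral_curve F (u y) (- e') (t + e'),
        forall s, 0 <= s <= t -> `|u y s| <= B &
        forall s, 0 <= s <= t -> `|u y s - g s| <= C * `|y - g 0|]].
Proof.
(* The estimates run up to some [t'] beyond [t], since the new curves must solve the equation on an
   open interval containing [t]. *)
move=> t0 e0 hg; pose t' := t + e / 2.
have t'0 : 0 <= t' by rewrite addr_ge0 // divr_ge0 // ltW.
have ing s : 0 <= s <= t' -> - e < s < t + e.
  by rewrite /t' => /andP[? ?]; lra.
have [B0 [B00 hB0]] := @path_bounded _ _ g 0 t'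
  (fun s st => integral_curve_continuous hg (ing s st)).
have [B BE] : exists B, B = B0 + 1 by exists (B0 + 1).
have Bge0 : 0 <= B by rewrite BE; lra.
have [L [L0 hL]] := field_box_lipschitz F_C1 B.
have [C [C0 hC]] := @gronwall R m L t' (ltW L0) t'0.
have /choice[u hu] y := clamped_global_curve y F_C1 Bge0.
have le_tt' s : 0 <= s <= t -> 0 <= s <= t'.
  by rewrite /t' => /andP[? ?]; lra.
(* This radius d gives C d <= 1, for the distance to [g], and also d < 1, which puts the initial
   point strictly inside the box. *)
exists B, C, (C + 2)^-1, u; split => //.
- by rewrite invr_gt0; lra.
- by move=> s /le_tt' /hB0 h; apply: le_trans h _; rewrite BE; lra.
move=> y yd; have [uy0 duy] := hu y.
have close s : 0 <= s <= t' -> `|u y s - g s| <= C * `|y - g 0|.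
  move=> st; have := hC (fun s => u y s - g s)
    (fun s => F (clamp_rV B (u y s)) - F (g s)) 0 (lexx _) _ _ s st.
  rewrite uy0 addr0; apply.
    by move=> r rt; have := is_derive_rV_sub (duy r) (hg r (ing r rt)).
  move=> r rt; rewrite addr0.
  have grB : `|g r| <= B by apply: le_trans (hB0 r rt) _; rewrite BE; lra.
  apply: le_trans (hL _ _ (clamp_rV_norm _ Bge0) grB) _; rewrite ler_pM2l //.
  by rewrite -{1}(clamp_rV_id grB); apply: clamp_rV_lipschitz.
have Cd : C * `|y - g 0| <= 1.
  apply: le_trans (_ : C / (C + 2) <= _); first by rewrite ler_pM2l.
  by rewrite ler_pdivrMr; lra.
have uB s : 0 <= s <= t' -> `|u y s| <= B.
  move=> st; rewrite -[u y s](subrK (g s)); apply: le_trans (ler_normD _ _) _.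
  by rewrite BE addrC lerD ?hB0 // (le_trans (close s st)).
have y_lt : `|u y 0| < B.
  rewrite uy0 -[y](subrK (g 0)); apply: le_lt_trans (ler_normD _ _) _.
  have h0 : `|g 0| <= B0 by apply: hB0; rewrite lexx.
  have : (C + 2)^-1 < 1 by rewrite invf_lt1; lra.
  by rewrite BE; lra.
(* Gronwall covers forward times only; at small negative times the curve stays in the box by
   continuity at 0. *)
have [e1 [e10 he1]] : exists e1, 0 < e1 /\
    forall s, `|s| < e1 -> `|u y s| <= B.
  have c0 : {for 0, continuous (fun s => `|u y s|)}.
    apply: continuous_comp; last exact: norm_continuous.
    exact: is_derive_continuous (duy 0).
  have /(cvgr_lt _) /(_ _ y_lt) := c0.
  move=> /nbhs_ballP[e1 /= e10 he1]; exists e1; split => // s se1.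
  by apply/ltW/he1; rewrite -ball_normE /= sub0r normrN.
split => //; last 2 first.
- by move=> s /le_tt'; apply: uB.
- by move=> s /le_tt'; apply: close.
exists (Num.min e1 (e / 2)); first by rewrite lt_min e10 divr_gt0.
move=> s /andP[sl su]; have := duy s.
rewrite clamp_rV_id //.
have [s0|s0] := leP 0 s.
  apply: uB; rewrite s0 /=; apply: le_trans (ltW su) _.
  by rewrite /t' lerD2l ge_min lexx orbT.
apply: he1; rewrite ltr0_norm // ltrNl; apply: le_lt_trans sl.
by rewrite lerN2 ge_min lexx.
Qed.

(** The fundamental matrix in row convention: row [i] solves the variational equation started at the
    basis vector [i], and linearity gives every [v *m W]. Time is clamped so that the coefficients
    are continuous and bounded on the whole line. *)
Lemma variational_flow :
  0 <= t -> 0 < e -> integral_curve F g (- e) (t + e) -> exists W : R -> 'M[R]_m,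
  W 0 = 1%:M /\ forall v (s : R), 0 <= s <= t ->
    is_derive s 1 (fun r => v *m W r) (field_deriv F (g s) (v *m W s)).
Proof.
move=> t0 e0 hg.
have ing s : 0 <= s <= t -> - e < s < t + e by move=> /andP[? ?]; lra.
have [B [B0 hB]] := @path_bounded _ _ g 0 t
  (fun s st => integral_curve_continuous hg (ing s st)).
pose h s := g (clamp 0 t s).
have ch : continuous h.
  move=> s; apply: (@continuous_comp _ _ _ (clamp 0 t) g).
    apply: (lipschitz_continuous ltr01) => x y; rewrite mul1r.
    exact: clamp_lipschitz.
  exact: integral_curve_continuous hg (ing _ (clamp_itv s t0)).
have hhB s : `|h s| <= B by apply: hB; apply: clamp_itv.
have /choice[w hw] (i : 'I_m) := linear_global_curve (delta_mx 0 i) F_C1 ch hhB.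
exists (fun s => \matrix_i w i s); split.
  by apply/row_matrixP => i; rewrite rowK (hw i).1 row1.
move=> v s st; rewrite field_deriv_mulmx.
apply: (is_derive_mulmx_l (dW := fun s =>
  \matrix_i field_deriv F (g s) (row i (\matrix_i0 w i0 s)))) => i.
rewrite !rowK; under eq_fun do rewrite rowK.
by have := (hw i).2 s; rewrite /h clamp_id.
Qed.

(** The defect r = u - g - h W starts at 0, and r' is the linearised field applied to r plus the
    Taylor remainder of [F] in direction u - g. That remainder is at most eps' C |h|, so Gronwall
    bounds r by C2 eps' C |h|; this dictates [eps']. *)
Lemma nearby_curves_expansion (B C d : R) (u : 'rV[R]_m -> R -> 'rV[R]_m)
    (W : R -> 'M[R]_m) :
  0 <= t -> 0 < e -> integral_curve F g (- e) (t + e) ->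
  0 < C -> 0 < d -> (forall s, 0 <= s <= t -> `|g s| <= B) ->
  (forall y, `|y - g 0| <= d ->
    [/\ u y 0 = y,
        exists2 e', 0 < e' & integral_curve F (u y) (- e') (t + e') &
        forall s, 0 <= s <= t -> `|u y s - g s| <= C * `|y - g 0|]) ->
  W 0 = 1%:M -> (forall v (s : R), 0 <= s <= t ->
    is_derive s 1 (fun r => v *m W r) (field_deriv F (g s) (v *m W s))) ->
  forall eps, 0 < eps -> exists d', 0 < d' /\ forall h, `|h| <= d' ->
    forall s, 0 <= s <= t -> `|u (g 0 + h) s - g s - h *m W s| <= eps * `|h|.
Proof.
move=> t0 e0 hg C0 d0 gB hu W0 hW eps eps0.
have ing s : 0 <= s <= t -> - e < s < t + e by move=> /andP[? ?]; lra.
have [L [L0 hL]] := field_deriv_box_bounded F_C1 B.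
have [C2 [C20 hC2]] := @gronwall R m L t (ltW L0) t0.
pose eps' := eps / (C2 * C).
have eps'0 : 0 < eps' by rewrite divr_gt0 // mulr_gt0.
have [d1 [d10 hd1]] := field_box_taylor F_C1 B eps'0.
exists (Num.min d (d1 / C)); split; first by rewrite lt_min d0 divr_gt0.
move=> h; rewrite le_min => /andP[hd hd1C] s st.
have [|uy0 [e' e'0 duy] close] := hu (g 0 + h).
  by rewrite addrC addKr.
have {}close r : 0 <= r <= t -> `|u (g 0 + h) r - g r| <= C * `|h|.
  by move=> rt; have := close r rt; rewrite [g 0 + h]addrC addrK.
have := hC2 (fun r => u (g 0 + h) r - g r - h *m W r)
  (fun r => F (u (g 0 + h) r) - F (g r) - field_deriv F (g r) (h *m W r))
  (eps' * (C * `|h|)) _ _ _ s st.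
rewrite uy0 W0 mulmx1 [g 0 + h]addrC addrK subrr normr0 add0r.
rewrite (_ : C2 * _ = eps * `|h|); last first.
  by rewrite /eps'; field; rewrite !gt_eqF.
apply.
- by apply: mulr_ge0; [exact: ltW | apply: mulr_ge0 => //; exact: ltW].
- move=> r rt; apply: is_derive_rV_sub; last exact: hW.
  apply: is_derive_rV_sub; last exact: (hg r (ing r rt)).
  rewrite [h + _]addrC; apply: duy; case/andP: rt => ? ?; lra.
move=> r rt; rewrite [h + _]addrC; set y := u _ r.
have yC : `|y - g r| <= C * `|h| by exact: close.
rewrite (_ : _ - _ - _ =
    (F (g r + (y - g r)) - F (g r) - field_deriv F (g r) (y - g r)) +
    field_deriv F (g r) (y - g r - h *m W r)); last first.
  by rewrite -(field_derivB _ _ (y - g r)) addrA subrK [g r + _]addrC subrK.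
apply: le_trans (ler_normD _ _) _; rewrite addrC lerD //.
  by apply: hL; apply: gB.
apply: le_trans (hd1 _ _ (gB r rt) _) _; last by rewrite ler_pM2l.
by apply: le_trans yC _; rewrite mulrC -ler_pdivlMr.
Qed.

End nearby.

(** * Hamiltonian flows *)

Lemma differentiable_expansion (R : realType) (V W : normedModType R)
    (f l : V -> W) (x : V) : linear l -> continuous l ->
  (forall eps, 0 < eps -> exists d, 0 < d /\ forall h, `|h| <= d ->
    `|f (x + h) - f x - l h| <= eps * `|h|) ->
  differentiable f x /\ 'd f x = l :> (V -> W).
Proof.
move=> linl cl hf.
pose lM := GRing.isLinear.Build _ _ _ _ _ linl.
pose L : {linear V -> W} := HB.pack l lM.
have expansion : f \o shift x = cst (f x) + L +o_ 0 id.
  apply/eqaddoP => _/posnumP[eps].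
  have [d [d0 hd]] := hf eps%:num (gt0 _).
  apply/nbhs_ballP; exists d => //= h; rewrite -ball_normE /= sub0r normrN.
  move=> /ltW /hd; rewrite !fctE /= opprD addrA [h + x]addrC; exact.
have dE : 'd f x = L :> (V -> W) by apply: diff_unique.
by split => //; apply/diff_locallyP; rewrite dE.
Qed.

Lemma rV_functional_expansion (R : realType) m (S : 'rV[R]_m -> R)
    (y a : 'rV[R]_m) :
  (forall eps, 0 < eps -> exists d, 0 < d /\ forall k, `|k| <= d ->
    `|S (y + k) - S y - \sum_i k 0 i * a 0 i| <= eps * `|k|) ->
  differentiable S y /\ forall i, 'D_(delta_mx 0 i) S y = a 0 i.
Proof.
move=> hS; pose l (k : 'rV[R]_m) : R := \sum_i k 0 i * a 0 i.
have linl : linear l.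
  move=> c u v; transitivity (c * l u + l v) => //.
  rewrite /l mulr_sumr -big_split /=; apply: eq_bigr => i _.
  by rewrite !mxE mulrDl mulrA.
have cl : continuous l.
  apply: (@lipschitz_continuous _ _ _ _ (1 + \sum_i `|a 0 i|)).
    by rewrite ltr_pwDl // sumr_ge0.
  move=> u v; rewrite /l -sumrB; apply: le_trans (ler_norm_sum _ _ _) _.
  rewrite mulrDl mul1r ler_wpDl // mulr_suml ler_sum // => i _.
  rewrite -mulrBl normrM mulrC ler_wpM2l //.
  by have := rV_coord_le (u - v) i; rewrite !mxE.
have [dS dSE] := differentiable_expansion linl cl hS.
split => // i; rewrite deriveE // dSE /l (bigD1 i) //= big1 => [|j ji].
  by rewrite mxE !eqxx mul1r addr0.
by rewrite mxE (negbTE ji) andbF mul0r.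
Qed.

Lemma mulmxr_continuous (R : realType) m p (A : 'M[R]_(m, p)) :
  continuous (fun h : 'rV[R]_m => h *m A).
Proof.
apply: (@lipschitz_continuous _ _ _ _ (1 + m%:R * `|A|)).
  by rewrite ltr_pwDl // mulr_ge0.
move=> u v; rewrite -mulmxBl; set w := u - v.
apply: rV_norm_le => [|j]; first by rewrite mulr_ge0 // addr_ge0 // mulr_ge0.
rewrite mxE; apply: le_trans (ler_norm_sum _ _ _) _.
apply: le_trans (ler_sum _ (_ : forall i, true -> _ <= `|A| * `|w|)) _.
  move=> i _; rewrite normrM mulrC ler_pM // ?rV_coord_le //.
  rewrite [leRHS]/Num.Def.normr /= mx_normrE.
  exact: (le_bigmax _ (fun ij => `|A ij.1 ij.2|) (i, j)).
rewrite sumr_const card_ord -[leLHS]mulr_natl mulrA.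
by rewrite ler_wpM2r // lerDr.
Qed.

Lemma locally_lipschitz_continuous (R : realType) (V W : normedModType R)
    (f : V -> W) (x : V) (r L : R) : 0 < r -> 0 < L ->
  (forall y, `|x - y| < r -> `|f x - f y| <= L * `|x - y|) ->
  {for x, continuous f}.
Proof.
move=> r0 L0 h; apply/cvgrPdist_le => e e0.
apply/nbhs_ballP; exists (Num.min r (e / L)) => /=.
  by rewrite lt_min r0 divr_gt0.
move=> y; rewrite -ball_normE /= lt_min => /andP[xyr xye].
by apply: le_trans (h y xyr) _; rewrite mulrC -ler_pdivlMr // ltW.
Qed.

Lemma C1_fun_continuous (R : realType) m (f : 'rV[R]_m -> R) :
  C1_fun f -> continuous f.
Proof.
move=> Cf x; have [L [L0 hL]] := C1_box_lipschitz (`|x| + 1) Cf.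
apply: (locally_lipschitz_continuous ltr01 L0) => y xy1.
apply: hL; first by rewrite lerDl.
rewrite -[y](subrK x); apply: le_trans (ler_normD _ _) _.
by rewrite addrC lerD2l distrC ltW.
Qed.

Section hamiltonian.
Variables (R : realType) (n : nat) (H : 'rV[R]_(n + n) -> R).
Local Notation V := 'rV[R]_(n + n).
Hypothesis H_C2 : C2 H.

Definition ham_field (x : V) : V := grad H x *m (Jmx R n)^T.

Lemma ham_fieldE x :
  ham_field x = row_mx (rsubmx (grad H x)) (- lsubmx (grad H x)).
Proof.
rewrite /ham_field /Jmx tr_block_mx -[X in X *m _]hsubmxK mul_row_block.
by rewrite !trmx0 linearN /= !trmx1 !mulmx0 add0r addr0 mulmxN !mulmx1.
Qed.

Lemma ham_field_lshift x i :
  ham_field x 0 (lshift n i) = partial (rshift n i) H x.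
Proof. by rewrite ham_fieldE row_mxEl !mxE. Qed.

Lemma ham_field_rshift x i :
  ham_field x 0 (rshift n i) = - partial (lshift n i) H x.
Proof. by rewrite ham_fieldE row_mxEr !mxE. Qed.

Lemma C1_fun_hamiltonian : C1_fun H.
Proof. by case: H_C2 => [dH [_ [cH _]]]; split; [exact: dH | exact: cH]. Qed.

Lemma C1_fun_partial i : C1_fun (partial i H).
Proof. by case: H_C2 => [_ [ddH [_ cH]]]; split; [exact: ddH | exact: cH]. Qed.

Lemma C1_fun_oppr m (f : 'rV[R]_m -> R) : C1_fun f -> C1_fun (fun x => - f x).
Proof.
move=> [df cf]; split=> [j x|j]; first exact: derivableN.
rewrite (_ : (fun _ => _) = fun x => - 'D_(delta_mx 0 j) f x).
  move=> x; have := @cvgN _ _ _ _ _ _ _ (cf j x); exact.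
by apply/funext => x; rewrite deriveN.
Qed.

Lemma ham_field_C1 : C1_field ham_field.
Proof.
move=> i; case: (split_ordP i) => j ->.
  under eq_fun do rewrite ham_field_lshift; exact: C1_fun_partial.
under eq_fun do rewrite ham_field_rshift; exact/C1_fun_oppr/C1_fun_partial.
Qed.

Lemma is_solutionP g (a b : R) :
  is_solution H g a b <-> integral_curve ham_field g a b.
Proof.
split=> h s sab; first by have [dg gE] := h s sab; split; rewrite // -derive1E.
have [dg gE] := h s sab; split; first exact: dg.
by rewrite derive1E; exact: gE.
Qed.

(** [flow] picks the endpoint of some integral curve; uniqueness identifies it with the value of any
    given one, at each intermediate time too. *)
Lemma flow_unique g (e t : R) : 0 <= t -> 0 < e ->
  integral_curve ham_field g (- e) (t + e) ->
  forall s, 0 <= s <= t -> flow_dom H s (g 0) /\ flow H s (g 0) = g s.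
Proof.
move=> t0 e0 hg s /andP[s0 st].
have gs : is_solution H g (Num.min 0 s - e) (Num.max 0 s + e).
  rewrite (min_idPl s0) (max_idPr s0) sub0r; apply/is_solutionP => r /andP[re rs].
  by apply: hg; rewrite re (lt_le_trans rs) // lerD2r.
split; first by exists g, e.
rewrite /flow; case: xgetP => [y _ [g' [e' [e'0 [g'0 [hg' <-]]]]]|none].
  move: hg'; rewrite (min_idPl s0) (max_idPr s0) sub0r => /is_solutionP hg'.
  move: gs; rewrite (min_idPl s0) (max_idPr s0) sub0r => /is_solutionP gs.
  by apply: (integral_curve_unique ham_field_C1 s0 e'0 e0 hg' gs g'0);
    rewrite s0 lexx.
by case: (none (g s)); exists g, e.
Qed.

Lemma flow_domP (t : R) x : 0 <= t -> flow_dom H t x ->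
  exists (g : R -> V) (e : R),
    [/\ 0 < e, g 0 = x & integral_curve ham_field g (- e) (t + e)].
Proof.
move=> t0 [g [e [e0 [g0 hg]]]]; exists g, e; split => //.
by move: hg; rewrite (min_idPl t0) (max_idPr t0) sub0r => /is_solutionP.
Qed.

(** One [W] serves all times up to [t]: its evolution carries the growth estimate, its final value
    the derivative. Points being rows, [W t] is the transpose of [jac]. *)
Lemma flow_differentiable (t : R) x : 0 <= t -> flow_dom H t x ->
  exists W : R -> 'M[R]_(n + n),
    [/\ W 0 = 1%:M,
        forall v (s : R), 0 <= s <= t -> is_derive s 1 (fun r => v *m W r)
          (field_deriv ham_field (flow H s x) (v *m W s)),
        differentiable (flow H t) x &
        'd (flow H t) x = (fun h => h *m W t) :> (V -> V)].
Proof.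
move=> t0 /(flow_domP t0)[g [e [e0 g0 hg]]].
have [B [C [d [u [C0 d0 gB hu]]]]] := nearby_curves ham_field_C1 t0 e0 hg.
have [W [W0 hW]] := variational_flow ham_field_C1 t0 e0 hg.
have fg s : 0 <= s <= t -> flow H s x = g s.
  by move=> st; rewrite -g0; exact: (flow_unique t0 e0 hg st).2.
have tt : 0 <= t <= t by rewrite t0 lexx.
have expansion := nearby_curves_expansion ham_field_C1 t0 e0 hg C0 d0 gB _ W0 hW.
exists W; have [|||dif difE] := @differentiable_expansion _ _ _ (flow H t)
    (fun h : V => h *m W t) x.
- by move=> c a b; rewrite mulmxDl scalemxAl.
- exact: mulmxr_continuous.
- move=> eps eps0; have [|d' [d'0 hd']] := expansion u _ eps eps0.
    by move=> y yd; have [? ? ? ?] := hu y yd; split.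
  exists (Num.min d d'); split; first by rewrite lt_min d0.
  move=> h; rewrite le_min => /andP[hd hd1].
  have [|uy0 [e' e'0 uy] _ _] := hu (x + h).
    by rewrite g0 [x + h]addrC addrK.
  have [_] := flow_unique t0 e'0 uy tt; rewrite uy0 => ->.
  by rewrite (fg _ tt) -{1}g0; apply: hd'.
split; [exact: W0 | | exact: dif | exact: difE].
by move=> v s st; rewrite fg //; exact: hW.
Qed.

Lemma flow_nearby (t : R) x : 0 <= t -> flow_dom H t x ->
  exists B C d : R, [/\ 0 < C, 0 < d &
    forall y, `|y - x| <= d ->
      [/\ flow_dom H t y, forall s, 0 <= s <= t -> `|flow H s y| <= B &
      forall s, 0 <= s <= t -> `|flow H s y - flow H s x| <= C * `|y - x|]].
Proof.
move=> t0 /(flow_domP t0)[g [e [e0 g0 hg]]].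
have [B [C [d [u [C0 d0 gB hu]]]]] := nearby_curves ham_field_C1 t0 e0 hg.
exists B, C, d; split => // y yd.
have [|uy0 [e' e'0 uy] uB ug] := hu y; first by rewrite g0.
have fg s : 0 <= s <= t -> flow H s x = g s.
  by move=> st; rewrite -g0; exact: (flow_unique t0 e0 hg st).2.
have fu s : 0 <= s <= t -> flow_dom H s y /\ flow H s y = u y s.
  by move=> st; have := flow_unique t0 e'0 uy st; rewrite uy0.
split; first by apply: (fu t _).1; rewrite t0 lexx.
  by move=> s st; rewrite (fu s st).2; apply: uB.
by move=> s st; rewrite (fu s st).2 fg // -g0; apply: ug.
Qed.

End hamiltonian.

Lemma is_derive_norm_le (R : realType) (f df : R -> R) (a b M : R) : a <= b ->
  (forall s, a <= s <= b -> is_derive s 1 f (df s)) ->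
  (forall s, a <= s <= b -> `|df s| <= M) ->
  `|f b - f a| <= M * (b - a).
Proof.
move=> ab hf hM.
have hlin (c s : R) : is_derive s 1 (fun y => c * y) c.
  by have := is_derive_cmulf c (is_derive_id s (1 : R)); rewrite mulr1.
rewrite ler_norml; apply/andP; split.
  have := is_derive_le ab (fun s _ => hlin (- M) s) hf.
  rewrite -mulrBr mulNr; apply => s /hM.
  by rewrite ler_norml => /andP[].
have := is_derive_le ab hf (fun s _ => hlin M s).
rewrite -mulrBr; apply => s /hM.
by rewrite ler_norml => /andP[].
Qed.

Section action.
Variables (R : realType) (n : nat) (H : 'rV[R]_(n + n) -> R).
Local Notation V := 'rV[R]_(n + n).
Hypothesis H_C2 : C2 H.

(** The integrand p . q' - H of the action, with q' replaced by the momentum derivative of [H]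
    according to Hamilton's equations. *)
Definition lagrangian (x : V) : R :=
  \sum_(i < n) x 0 (rshift n i) * partial (rshift n i) H x - H x.

Lemma lagrangian_continuous : continuous lagrangian.
Proof.
have c1 : continuous (fun x : V =>
    \sum_(i < n) x 0 (rshift n i) * partial (rshift n i) H x).
  apply: continuous_big => [|i _ x]; first exact: add_continuous.
  apply: continuousM; first exact: coord_continuous.
  exact: (C1_fun_continuous (C1_fun_partial H_C2 (rshift n i))).
move=> x; apply: continuousB; first exact: c1.
exact: (C1_fun_continuous (C1_fun_hamiltonian H_C2)).
Qed.

(** Encoded as the increment of any primitive of the Lagrangian along any integral curve from [x];
    [actionE] shows that the choices do not matter. The default 0 occurs only where no such data
    exist. *)
Definition action (t : R) (x : V) : R :=
  xget 0 [set a | exists (g : R -> V) (e : R) (z : R -> R),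
    [/\ 0 < e, g 0 = x, integral_curve (ham_field H) g (- e) (t + e),
        forall s : R, 0 <= s <= t -> is_derive s 1 z (lagrangian (g s)) &
        a = z t - z 0]].

Lemma actionE (t e : R) g (z : R -> R) : 0 <= t -> 0 < e ->
  integral_curve (ham_field H) g (- e) (t + e) ->
  (forall s : R, 0 <= s <= t -> is_derive s 1 z (lagrangian (g s))) ->
  action t (g 0) = z t - z 0.
Proof.
move=> t0 e0 hg hz; rewrite /action; case: xgetP => [a _|none].
  move=> [g' [e' [z' [e'0 g'0 hg' hz' ->]]]].
  apply: (is_derive_eq_on t0 (d := fun s => lagrangian (g s))) => // s st.
  rewrite -(integral_curve_unique (ham_field_C1 H_C2) t0 e'0 e0 hg' hg g'0 st).
  exact: hz'.
by case: (none (z t - z 0)); exists g, e, z.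
Qed.

Lemma action_primitive (t e : R) g : 0 <= t -> 0 < e ->
  integral_curve (ham_field H) g (- e) (t + e) ->
  exists z : R -> R,
    forall s : R, 0 <= s <= t -> is_derive s 1 z (lagrangian (g s)).
Proof.
move=> t0 e0 hg.
have ch : continuous (fun s => lagrangian (g (clamp 0 t s))).
  move=> s; apply: (@continuous_comp _ _ _ (fun s => g (clamp 0 t s))).
    apply: (@continuous_comp _ _ _ (clamp 0 t) g).
      apply: (lipschitz_continuous ltr01) => x y; rewrite mul1r.
      exact: clamp_lipschitz.
    apply: (integral_curve_continuous hg).
    by have /andP[? ?] := clamp_itv s t0; lra.
  exact: lagrangian_continuous.
have [z [_ hz]] := continuous_primitive ch.
by exists z => s st; have := hz s; rewrite clamp_id.
Qed.

(* d/ds (z_y - z_x - p_x . (q_y - q_x)) is the second-order Taylor remainder of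
   H between the two curves plus (p_y - p_x) . (H_p(y) - H_p(x)): both are
   quadratic in the distance. *)
Lemma action_expansion (t : R) x : 0 <= t -> flow_dom H t x ->
  exists C d : R, [/\ 0 < C, 0 < d & forall y, `|y - x| <= d ->
    `|action t y - action t x -
      (\sum_(i < n) (flow H t x) 0 (rshift n i) *
         (flow H t y - flow H t x) 0 (lshift n i) -
       \sum_(i < n) x 0 (rshift n i) * (y - x) 0 (lshift n i))|
    <= C * `|y - x| ^+ 2].
Proof.
move=> t0 /(flow_domP t0)[g [e [e0 g0 hg]]].
have [B [C [d [u [C0 d0 gB hu]]]]] := nearby_curves (ham_field_C1 H_C2) t0 e0 hg.
have [L [L0 hL]] := field_box_lipschitz (ham_field_C1 H_C2) B.
have [M [M0 hM]] := C2_box_taylor B (C1_fun_hamiltonian H_C2)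
  (C1_fun_partial H_C2).
have tt : 0 <= t <= t by rewrite t0 lexx.
(* [n%:R * L] is for the pairing of the momentum and velocity differences, [M] for the Taylor
   remainder of [H]. *)
pose N := n%:R * L + M.
have N0 : 0 < N by rewrite ltr_wpDl // mulr_ge0 // ltW.
exists (N * C ^+ 2 * t + 1), d; split => //.
  by rewrite ltr_wpDl // !mulr_ge0 ?sqr_ge0 // ltW.
move=> y yd; have [|uy0 [e' e'0 uy] uB ug] := hu y; first by rewrite g0.
have [_ fx] := flow_unique H_C2 t0 e0 hg tt.
have [_ fy] := flow_unique H_C2 t0 e'0 uy tt.
have [zx hzx] := action_primitive t0 e0 hg.
have [zy hzy] := action_primitive t0 e'0 uy.
have Ax := actionE t0 e0 hg hzx.
have Ay := actionE t0 e'0 uy hzy.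
rewrite g0 in fx Ax ug; rewrite uy0 in fy Ay; rewrite {}fx {}fy {}Ax {}Ay.
pose E s := zy s - zx s -
  \sum_(i < n) g s 0 (rshift n i) * (u y s 0 (lshift n i) - g s 0 (lshift n i)).
pose dE s := lagrangian (u y s) - lagrangian (g s) -
  \sum_(i < n) (g s 0 (rshift n i) * (ham_field H (u y s) 0 (lshift n i) -
                                      ham_field H (g s) 0 (lshift n i)) +
    (u y s 0 (lshift n i) - g s 0 (lshift n i)) *
      ham_field H (g s) 0 (rshift n i)).
have hE s : 0 <= s <= t -> is_derive s 1 E (dE s).
  move=> st; have h1 := hzx s st; have h2 := hzy s st.
  have ing : - e < s < t + e by case/andP: st => ? ?; lra.
  have iny : - e' < s < t + e' by case/andP: st => ? ?; lra.
  have /is_derive_rVP hgs := hg s ing; have /is_derive_rVP hus := uy s iny.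
  apply: (is_derive_subf (is_derive_subf h2 h1)).
  apply: is_derive_sumf => i.
  have := is_derive_mulf (hgs (rshift n i))
    (is_derive_subf (hus (lshift n i)) (hgs (lshift n i))).
  exact.
have subE (a b : V) j : (a - b) 0 j = a 0 j - b 0 j by rewrite !mxE.
have dE_eq s : dE s = \sum_(i < n) (u y s - g s) 0 (rshift n i) *
      (ham_field H (u y s) - ham_field H (g s)) 0 (lshift n i) -
    (H (g s + (u y s - g s)) - H (g s) -
      \sum_j (u y s - g s) 0 j * partial j H (g s)).
  rewrite [g s + _]addrC subrK big_split_ord /= /dE /lagrangian.
  set a := \sum_i _; set b := \sum_i _; set c := \sum_i _.
  set a' := \sum_i _; set b' := \sum_i _; set c' := \sum_i _.
  suff : a - b - c = a' + b' + c' by lra.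
  rewrite -!sumrB -!big_split /=; apply: eq_bigr => i _.
  by rewrite !subE !ham_field_lshift !ham_field_rshift; ring.
have dE_le s : 0 <= s <= t -> `|dE s| <= N * C ^+ 2 * `|y - x| ^+ 2.
  move=> st; rewrite dE_eq; have kC := ug s st.
  have gsB := gB s st; have usB := uB s st.
  have k2 : `|u y s - g s| ^+ 2 <= C ^+ 2 * `|y - x| ^+ 2.
    by rewrite -exprMn ler_pXn2r ?nnegrE // mulr_ge0 // ltW.
  apply: (@le_trans _ _ (N * `|u y s - g s| ^+ 2)); last first.
    by rewrite -mulrA ler_pM2l.
  apply: le_trans (ler_normB _ _) _; rewrite mulrDl lerD //.
    apply: le_trans (ler_norm_sum _ _ _) _.
    apply: le_trans (ler_sum _ (_ : forall i, true ->
      _ <= L * `|u y s - g s| ^+ 2)) _.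
      move=> i _; rewrite normrM expr2 mulrCA ler_pM // ?rV_coord_le //.
      by apply: le_trans (rV_coord_le _ _) _; apply: hL.
    by rewrite sumr_const card_ord -[leLHS]mulr_natl mulrA.
  by apply: hM => //; rewrite [g s + _]addrC subrK.
have := is_derive_norm_le t0 hE dE_le.
rewrite subr0 (_ : E t - E 0 = zy t - zy 0 - (zx t - zx 0) -
  (\sum_(i < n) g t 0 (rshift n i) * (u y t - g t) 0 (lshift n i) -
   \sum_(i < n) x 0 (rshift n i) * (y - x) 0 (lshift n i))).
  move=> /le_trans; apply; rewrite [leRHS]mulrDl mul1r.
  by rewrite [leLHS]mulrAC lerDl sqr_ge0.
rewrite /E uy0 g0.
under [X in _ = _ - (X - _)]eq_bigr do rewrite !mxE.
under [X in _ = _ - (_ - X)]eq_bigr do rewrite !mxE.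
by ring.
Qed.

End action.

(** * Euclidean estimates *)

Section euclidean.
Variables (R : realType) (n : nat).
Local Notation V := 'rV[R]_(n + n).
Implicit Types (a b v w : V) (A : 'M[R]_(n + n)) (c : R).

Lemma enorm_ge0 a : 0 <= enorm a.
Proof. exact: sqrtr_ge0. Qed.

Lemma enorm_sqr a : enorm a ^+ 2 = \sum_i a 0 i * a 0 i.
Proof.
rewrite /enorm sqr_sqrtr; first by apply: eq_bigr => i _; rewrite expr2.
by apply: sumr_ge0 => i _; rewrite sqr_ge0.
Qed.

Lemma coord_le_enorm a i : `|a 0 i| <= enorm a.
Proof.
rewrite -sqrtr_sqr ler_wsqrtr // (bigD1 i) //= lerDl.
by apply: sumr_ge0 => j _; rewrite sqr_ge0.
Qed.

Lemma enorm_eq0 a : enorm a = 0 -> a = 0.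
Proof.
move=> a0; apply/rowP => i; rewrite mxE; apply/eqP; rewrite -normr_le0 -a0.
exact: coord_le_enorm.
Qed.

Lemma enormZ c a : enorm (c *: a) = `|c| * enorm a.
Proof.
apply/eqP; rewrite -(@eqrXn2 _ 2) ?enorm_ge0 ?mulr_ge0 ?enorm_ge0 //.
rewrite exprMn !enorm_sqr real_normK ?num_real // expr2 mulr_sumr.
by apply/eqP; apply: eq_bigr => i _; rewrite !mxE; ring.
Qed.

(** Expand the nonnegative sum of (|b| a_i - |a| b_i)^2 and cancel |a| |b|; zero vectors are treated
    apart. *)
Lemma cauchy_schwarz a b : `|\sum_i a 0 i * b 0 i| <= enorm a * enorm b.
Proof.
have key a' b' : \sum_i a' 0 i * b' 0 i <= enorm a' * enorm b'.
  have := enorm_ge0 a'; rewrite le_eqVlt => /predU1P[/esym a0|a0].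
    rewrite a0 mul0r (enorm_eq0 a0) big1 // => i _.
    by rewrite mxE mul0r.
  have := enorm_ge0 b'; rewrite le_eqVlt => /predU1P[/esym b0|b0].
    rewrite b0 mulr0 (enorm_eq0 b0) big1 // => i _.
    by rewrite mxE mulr0.
  rewrite -(ler_pM2l (mulr_gt0 a0 b0)) -subr_ge0.
  have : 0 <= \sum_i (enorm b' * a' 0 i - enorm a' * b' 0 i) ^+ 2.
    by apply: sumr_ge0 => i _; rewrite sqr_ge0.
  suff -> : \sum_i (enorm b' * a' 0 i - enorm a' * b' 0 i) ^+ 2 =
      2 * (enorm a' * enorm b' * (enorm a' * enorm b') -
        enorm a' * enorm b' * \sum_i a' 0 i * b' 0 i) by lra.
  rewrite (_ : 2 * _ = enorm b' ^+ 2 * enorm a' ^+ 2 +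
    enorm a' ^+ 2 * enorm b' ^+ 2 -
    2 * enorm a' * enorm b' * \sum_i a' 0 i * b' 0 i); last by ring.
  rewrite [X in _ * X + _]enorm_sqr [X in _ + _ * X - _]enorm_sqr.
  rewrite !mulr_sumr -big_split -sumrB; apply: eq_bigr => i _ /=; ring.
rewrite ler_norml key andbT lerNl -sumrN.
have := key (- a) b; rewrite -scaleN1r enormZ normrN1 mul1r.
by under eq_bigr do rewrite !mxE mulN1r mulNr.
Qed.

Lemma enorm_le a c : 0 <= c -> (forall i, `|a 0 i| <= c) ->
  enorm a <= (n + n)%:R * c.
Proof.
move=> c0 h; set N : R := (n + n)%:R.
have Nc0 : 0 <= N * c by rewrite mulr_ge0.
rewrite -(@ler_pXn2r _ 2) ?nnegrE ?enorm_ge0 // enorm_sqr.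
apply: le_trans (ler_sum _ (_ : forall i, true -> _ <= c ^+ 2)) _.
  move=> i _; apply: le_trans (ler_norm _) _.
  by rewrite normrM expr2 ler_pM.
rewrite sumr_const card_ord -[leLHS]mulr_natl exprMn ler_wpM2r ?sqr_ge0 //.
by rewrite /N -natrX ler_nat -mulnn; case: (n + n)%N => // k; rewrite leq_pmulr.
Qed.

(** The crude dimensional constants are harmless: they only show that the sets under [sup] in
    [opnorm2] and [LK] are bounded, so that [sup] dominates their elements. *)
Lemma enorm_mulmx_le A v c : 0 <= c -> (forall i j, `|A i j| <= c) ->
  enorm (v *m A^T) <= (n + n)%:R * ((n + n)%:R * (enorm v * c)).
Proof.
move=> c0 h; apply: enorm_le; first by rewrite !mulr_ge0 ?enorm_ge0.
move=> i; rewrite mxE; apply: le_trans (ler_norm_sum _ _ _) _.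
apply: le_trans (ler_sum _ (_ : forall j, true -> _ <= enorm v * c)) _.
  by move=> j _; rewrite normrM mxE ler_pM // coord_le_enorm.
by rewrite sumr_const card_ord -[leLHS]mulr_natl.
Qed.

Lemma opnorm2_le A c : 0 <= c -> (forall i j, `|A i j| <= c) ->
  opnorm2 A <= (n + n)%:R * ((n + n)%:R * c).
Proof.
move=> c0 h; rewrite /opnorm2; set E := [set _ | _ in _].
(* For n = 0 no vector has norm 1, and the supremum of the empty set is 0. *)
have [->|E0] := eqVneq E set0; first by rewrite sup0 !mulr_ge0.
apply: ge_sup; first exact/set0P.
by move=> _ [v /= v1 <-]; have := enorm_mulmx_le v c0 h; rewrite v1 mul1r.
Qed.

Lemma enorm_mulmx_opnorm2 A v : enorm (v *m A^T) <= opnorm2 A * enorm v.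
Proof.
have := enorm_ge0 v; rewrite le_eqVlt => /predU1P[/esym v0|v0].
  rewrite v0 (enorm_eq0 v0) mul0mx mulr0.
  by rewrite -(scale0r (0 : V)) enormZ normr0 mul0r.
pose w := (enorm v)^-1 *: v.
have w1 : enorm w = 1.
  by rewrite enormZ ger0_norm ?invr_ge0 ?enorm_ge0 // mulVf // gt_eqF.
have vE : v = enorm v *: w by rewrite /w scalerA divff ?gt_eqF // scale1r.
rewrite {1}vE -scalemxAl enormZ (ger0_norm (ltW v0)) mulrC ler_pM2r //.
apply: ub_le_sup; last by exists w.
pose c := \sum_i \sum_j `|A i j|.
have c0 : 0 <= c by apply: sumr_ge0 => i _; apply: sumr_ge0.
have hc i j : `|A i j| <= c.
  rewrite /c (bigD1 i) //= (bigD1 j) //= -addrA lerDl.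
  by rewrite addr_ge0 ?sumr_ge0 // => k _; rewrite sumr_ge0.
exists ((n + n)%:R * ((n + n)%:R * c)) => _ [z /= z1 <-].
by have := enorm_mulmx_le z c0 hc; rewrite z1 mul1r.
Qed.

Lemma LK_opnorm2 (H : V -> R) (K : set V) y : C2 H -> compact K -> K y ->
  opnorm2 (hess H y) <= LK H K.
Proof.
move=> H_C2 cK Ky; apply: ub_le_sup; last by exists y.
have [B [_ hB]] := compact_bounded cK.
have KB x : K x -> `|x| <= `|B| + 1.
  by apply: hB; rewrite (le_lt_trans (ler_norm B)) // ltrDl.
have /choice[M hM] (i : 'I_(n + n)) :=
  deriv_box_bounded (`|B| + 1) (C1_fun_partial H_C2 i).
pose c := \sum_i M i.
have c0 : 0 <= c by apply: sumr_ge0 => i _; exact/ltW/(hM i).1.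
exists ((n + n)%:R * ((n + n)%:R * c)) => _ [z Kz <-].
apply: opnorm2_le => // i j; rewrite mxE.
apply: le_trans ((hM i).2 j z (KB z Kz)) _.
rewrite /c (bigD1 i) //= lerDl; apply: sumr_ge0 => k _.
exact/ltW/(hM k).1.
Qed.

(** J is orthogonal: it swaps the two halves of the Hessian image and flips one sign. Thus the
    Hessian norm is the growth rate of the variational equation. *)
Lemma enorm_ham_field_deriv (H : V -> R) x w : C2 H ->
  enorm (field_deriv (ham_field H) x w) = enorm (w *m (hess H x)^T).
Proof.
move=> H_C2.
have D i j : 'D_(delta_mx 0 j) (fun y => ham_field H y 0 (rshift n i)) x =
    - partial j (partial (lshift n i) H) x.
  under [X in derive X _ _]eq_fun do rewrite ham_field_rshift.
  by rewrite deriveN //; exact: (C1_fun_partial H_C2 _).1.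
have D' i j : 'D_(delta_mx 0 j) (fun y => ham_field H y 0 (lshift n i)) x =
    partial j (partial (rshift n i) H) x.
  by under [X in derive X _ _]eq_fun do rewrite ham_field_lshift.
apply/eqP; rewrite -(@eqrXn2 _ 2) ?enorm_ge0 // !enorm_sqr !big_split_ord /=.
apply/eqP; rewrite addrC; congr (_ + _); apply: eq_bigr => i _; rewrite !mxE.
  under eq_bigr do rewrite D mulrN.
  rewrite sumrN mulrNN; congr (_ * _); apply: eq_bigr => j _; by rewrite !mxE.
under eq_bigr do rewrite D'.
by congr (_ * _); apply: eq_bigr => j _; rewrite !mxE.
Qed.

Lemma ham_field_deriv_le_LK (H : V -> R) (K : set V) x w : C2 H -> compact K ->
  K x -> enorm (field_deriv (ham_field H) x w) <= LK H K * enorm w.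
Proof.
move=> H_C2 cK Kx; rewrite enorm_ham_field_deriv //.
apply: le_trans (enorm_mulmx_opnorm2 _ _) _.
by rewrite ler_wpM2r ?enorm_ge0 // LK_opnorm2.
Qed.

(* [w . v >= |v|^2 (2 - e^(L t))] because [(w . v)' >= - L |v| |w|] and
   [|w| <= e^(L s) |v|]. *)
Lemma linear_curve_angle (w dw : R -> V) (L t : R) : 0 <= L -> 0 <= t ->
  (forall s : R, 0 <= s <= t -> is_derive s 1 w (dw s)) ->
  (forall s, 0 <= s <= t -> enorm (dw s) <= L * enorm (w s)) ->
  enorm (w 0) ^+ 2 * (2 - expR (L * t)) <= \sum_i w 0 0 i * w t 0 i.
Proof.
move=> L0 t0 hw hdw; set v := w 0.
have sub s r : 0 <= s <= t -> 0 <= r <= s -> 0 <= r <= t.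
  by move=> /andP[_ st] /andP[-> /le_trans]; apply.
(* The constant log 2 needs the exact rate [L], whereas [gronwall] loses dimensional factors; so
   e^(-2 L s) |w|^2 is shown to be nonincreasing in the Euclidean norm. *)
have grow s : 0 <= s <= t -> enorm (w s) <= expR (L * s) * enorm v.
  move=> st; have s0 : 0 <= s by case/andP: st.
  pose phi r := \sum_i w r 0 i * w r 0 i.
  pose dphi r := \sum_i (w r 0 i * dw r 0 i + w r 0 i * dw r 0 i).
  have hphi r : 0 <= r <= t -> is_derive r 1 phi (dphi r).
    move=> rt; apply: is_derive_sumf => i.
    by have /is_derive_rVP/(_ i) h := hw r rt; exact: is_derive_mulf.
  have hpsi r : 0 <= r <= s -> is_derive r 1
      (fun r => expR (- (2 * L) * r) * phi r)
      (expR (- (2 * L) * r) * dphi r +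
       phi r * (- (2 * L) * expR (- (2 * L) * r))).
    move=> rs; apply: is_derive_mulf; first exact: is_derive_expRM.
    exact: hphi (sub s r st rs).
  have := is_derive_le s0 hpsi (fun r _ => is_derive_cst 0 r (1 : R)).
  rewrite /cst subrr mulr0 expR0 mul1r => /(_ _) psi_le.
  have {}psi_le : expR (- (2 * L) * s) * phi s - phi 0 <= 0.
    apply: psi_le => r rs; have rt := sub s r st rs.
    rewrite (_ : _ + _ = expR (- (2 * L) * r) * (dphi r - 2 * L * phi r)).
      rewrite pmulr_rle0 ?expR_gt0 // /dphi /phi big_split -enorm_sqr.
      have := cauchy_schwarz (w r) (dw r); rewrite ler_norml => /andP[_].
      have : enorm (w r) * enorm (dw r) <= enorm (w r) * (L * enorm (w r)).
        by rewrite ler_wpM2l ?enorm_ge0 // hdw.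
      rewrite expr2 /=; lra.
    by ring.
  rewrite -(@ler_pXn2r _ 2) ?nnegrE ?mulr_ge0 ?enorm_ge0 ?expR_ge0 //.
  rewrite exprMn !enorm_sqr -/(phi s) -/(phi 0) -expRM_natl.
  rewrite (_ : phi s = expR (2 * (L * s)) * (expR (- (2 * L) * s) * phi s)).
    by rewrite ler_wpM2l ?expR_ge0 //; lra.
  by rewrite mulrA -expRD mulrA mulNr subrr expR0 mul1r.
have hf (s : R) : 0 <= s <= t ->
    is_derive s 1 (fun r => \sum_i v 0 i * w r 0 i) (\sum_i v 0 i * dw s 0 i).
  move=> st; apply: is_derive_sumf => i; apply: is_derive_cmulf.
  by have /is_derive_rVP := hw s st.
have hg (s : R) : 0 <= s <= t ->
    is_derive s 1 (fun r => - enorm v ^+ 2 * expR (L * r))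
      (- enorm v ^+ 2 * (L * expR (L * s))).
  by move=> st; apply: is_derive_cmulf; apply: is_derive_expRM.
have := is_derive_le t0 hg hf.
rewrite mulr0 expR0 mulr1 -/v -enorm_sqr => /(_ _) h.
suff : - enorm v ^+ 2 * expR (L * t) - - enorm v ^+ 2 <=
  \sum_i v 0 i * w t 0 i - enorm v ^+ 2 by lra.
apply: h => s st.
have := cauchy_schwarz v (dw s); rewrite ler_norml => /andP[+ _].
have : enorm v * enorm (dw s) <= enorm v * (L * (expR (L * s) * enorm v)).
  rewrite ler_wpM2l ?enorm_ge0 //; apply: le_trans (hdw s st) _.
  by rewrite ler_wpM2l // grow.
rewrite expr2; lra.
Qed.

End euclidean.

(** * Invertibility of the momentum block and the generating function *)

Lemma differentiable_expansion_bound (R : realType) (V W : normedModType R)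
    (f : V -> W) (x : V) : differentiable f x ->
  forall eps, 0 < eps -> exists d, 0 < d /\ forall h, `|h| <= d ->
    `|f (x + h) - f x - 'd f x h| <= eps * `|h|.
Proof.
move=> /diff_locallyP[_ /eqaddoP dxf] eps eps0.
have /nbhs_ballP[d /= d0 hd] := dxf eps eps0.
exists (d / 2); split; first by rewrite divr_gt0.
move=> h hd2; have := hd h; rewrite -ball_normE /= sub0r normrN.
rewrite !fctE /= opprD addrA [h + x]addrC; apply.
by apply: le_lt_trans hd2 _; lra.
Qed.

Lemma differentiable_lipschitz (R : realType) (V W : normedModType R)
    (f : V -> W) (x : V) : differentiable f x ->
  exists G d, [/\ 0 < G, 0 < d &
    forall h, `|h| <= d -> `|f (x + h) - f x| <= G * `|h|].
Proof.
move=> df; have [d [d0 hd]] := differentiable_expansion_bound df ltr01.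
have [k k0 hk] := linear_lipschitz (diff_continuous df).
exists (1 + k), d; split => //; first by rewrite addr_gt0.
move=> h hh; rewrite -[_ - _](subrK ('d f x h)).
apply: le_trans (ler_normD _ _) _; rewrite mulrDl lerD //.
exact: hd.
Qed.

Section flow_jacobian.
Variables (R : realType) (n : nat).
Local Notation V := 'rV[R]_(n + n).

(** [jac] is the transpose of [M], so the block is invertible as soon as the lower-right block of
    [M] kills no nonzero row [u]; the image of [u] under that block is the p-part of (0, u) M. *)
Lemma drsubmx_jac_unit (f : V -> V) x (M : 'M[R]_(n + n)) :
  'd f x = (fun h => h *m M) :> (V -> V) ->
  (forall u : 'rV[R]_n, rsubmx (row_mx 0 u *m M) = 0 -> u = 0) ->
  drsubmx (jac f x) \in unitmx.
Proof.
move=> dE hu.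
have -> : jac f x = M^T.
  congr (_^T); apply/matrixP => i j; rewrite mxE dE.
  by rewrite -rowE mxE.
rewrite -trmx_drsub unitmx_tr -row_free_unit -kermx_eq0.
apply/rowV0P => u /sub_kermxP uM; apply: hu.
rewrite -[M]submxK mul_row_block !mul0mx !add0r row_mxKr.
exact: uM.
Qed.

Lemma flow_jac_unit_invariant (H : V -> R) (K : set V) (t : R) x :
  C2 H -> compact K -> 0 <= t -> flow_dom H t x ->
  (forall s, 0 <= s <= t -> K (flow H s x)) ->
  0 <= LK H K -> expR (LK H K * t) < 2 ->
  drsubmx (jac (flow H t) x) \in unitmx.
Proof.
move=> H_C2 cK t0 dom invK L0 Lt.
have [W [W0 hW df dE]] := flow_differentiable H_C2 t0 dom.
apply: (drsubmx_jac_unit dE) => u hu; pose v : V := row_mx 0 u.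
have := @linear_curve_angle R n (fun s => v *m W s)
  (fun s => field_deriv (ham_field H) (flow H s x) (v *m W s)) _ t L0 t0
  (fun s st => hW v s st).
rewrite W0 mulmx1 => /(_ _) h.
have {h} : enorm v ^+ 2 * (2 - expR (LK H K * t)) <= 0.
  apply: le_trans (h _) _.
    by move=> s st; apply: ham_field_deriv_le_LK => //; exact: invK.
  (* The inner product of [v] and [v *m W t] vanishes: [v] has no q-part, and the p-part of
     [v *m W t] is zero by [hu]. *)
  rewrite big_split_ord /= !big1 ?addr0 // => i _.
    have /rowP/(_ i) := hu; rewrite !mxE => ->.
    by rewrite mulr0.
  by rewrite row_mxEl mxE mul0r.
rewrite pmulr_lle0; last lra.
move=> v0; have /enorm_eq0 : enorm v = 0.
  by apply/eqP; rewrite -sqrf_eq0 eq_le v0 sqr_ge0.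
by rewrite /v => /(congr1 rsubmx); rewrite row_mxKr => ->; rewrite linear0.
Qed.

(* For h in the kernel direction, psi (x + h) - psi x = o(h), which contradicts
   the Lipschitz estimate for the inverse of psi at psi x unless h = 0. *)
Lemma flow_jac_unit_chart (H : V -> R) (t : R) (U : set V) x :
  C2 H -> 0 <= t -> qP_chart H t U -> U x ->
  drsubmx (jac (flow H t) x) \in unitmx.
Proof.
move=> H_C2 t0 [oU [domU [_ [oW [_ [_ [g [gpsi [_ [dg _]]]]]]]]]] Ux.
have [W [_ _ df dE]] := flow_differentiable H_C2 t0 (domU x Ux).
apply: (drsubmx_jac_unit dE) => u hu; pose v : V := row_mx 0 u.
have [G [d1 [G0 d10 hG]]] := differentiable_lipschitz
  (dg (psi H t x) (ex_intro2 _ _ x Ux erefl)).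
(* This slope yields |h| <= G |k| <= |h| / 2 at the end, forcing h = 0. *)
have eps0 : 0 < (2 * G)^-1 by rewrite invr_gt0 mulr_gt0.
have [d2 [d20 hd2]] := differentiable_expansion_bound df eps0.
have /nbhs_ballP[d3 /= d30 hd3] := open_nbhs_nbhs (conj oU Ux).
(* The scaled vector must stay in the range of the flow expansion ([d2]), keep the moved point in
   [U] ([d3]), and have an image increment in the range of the Lipschitz bound for the inverse
   ([d1]). *)
have small : exists c, [/\ 0 < c, c * `|v| <= d2, c * `|v| < d3 &
    (2 * G)^-1 * (c * `|v|) <= d1].
  pose D := Num.min d2 (Num.min (d3 / 2) (d1 * (2 * G))).
  have D0 : 0 < D by rewrite !lt_min d20 !mulr_gt0 //= invr_gt0.
  exists (D / (`|v| + 1)).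
  have cv : D / (`|v| + 1) * `|v| <= D.
    by rewrite mulrAC ler_pdivrMr ?ltr_wpDl // ler_pM2l // lerDl.
  have [D1 D2 D3] : [/\ D <= d2, D <= d3 / 2 & D <= d1 * (2 * G)].
    by rewrite /D !ge_min !lexx !orbT.
  split; first by rewrite divr_gt0 // ltr_wpDl.
  - exact: le_trans cv D1.
  - by apply: le_lt_trans (le_trans cv D2) _; lra.
  - by rewrite mulrC ler_pdivrMr ?mulr_gt0 // (le_trans cv D3).
have [c [c0 cd2 cd3 cd1]] := small.
pose h := c *: v; have hn : `|h| = c * `|v| by rewrite normrZ gtr0_norm.
have Uxh : U (x + h).
  by apply: hd3; rewrite -ball_normE /= opprD addrA subrr sub0r normrN hn.
pose k := psi H t (x + h) - psi H t x.
have k_le : `|k| <= (2 * G)^-1 * `|h|.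
  have flow_le := hd2 h (_ : `|h| <= d2).
  rewrite hn in flow_le; have {}flow_le := flow_le cd2; rewrite -hn in flow_le.
  apply: rV_norm_le => [|i]; first by rewrite mulr_ge0 // ltW.
  rewrite /k /psi opp_row_mx add_row_mx; case: (split_ordP i) => j ->.
    rewrite row_mxEl linearD /= [_ + lsubmx h]addrC addrK.
    rewrite /h linearZ /= row_mxKl scaler0 mxE normr0.
    by rewrite mulr_ge0 // ltW.
  rewrite row_mxEr; apply: le_trans flow_le.
  have /rowP/(_ j) : rsubmx ('d (flow H t) x h) = 0.
    by rewrite dE /h -scalemxAl linearZ /= hu scaler0.
  rewrite mxE [RHS]mxE => dh0.
  have := rV_coord_le (flow H t (x + h) - flow H t x - 'd (flow H t) x h)
    (rshift n j).
  by rewrite !mxE dh0 subr0.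
have := hG k; rewrite /k [psi H t x + _]addrC subrK !gpsi //.
rewrite [x + h]addrC addrK [h + x]addrC => /(_ _) hk.
have {}hk : `|h| <= G * ((2 * G)^-1 * `|h|).
  apply: le_trans (hk _) _; last by rewrite ler_pM2l.
  by apply: le_trans k_le _; rewrite hn.
have : `|h| <= 0.
  move: hk; rewrite (_ : G * _ = `|h| / 2); first lra.
  by field; rewrite gt_eqF.
rewrite normr_le0 /h scaler_eq0 gt_eqF //= => /eqP.
by rewrite /v => /(congr1 rsubmx); rewrite row_mxKr => ->; rewrite linear0.
Qed.

Lemma grad_qP (y : V) : differentiable (@qP R n) y /\
  grad (@qP R n) y = row_mx (rsubmx y) (lsubmx y).
Proof.
have [|dq dqE] := @rV_functional_expansion R _ (@qP R n) y
    (row_mx (rsubmx y) (lsubmx y)).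
  move=> eps eps0; exists (eps / (n%:R + 1)); split.
    by rewrite divr_gt0 // ltr_wpDl.
  move=> k kd.
  (* [qP] is quadratic, so its remainder is exactly the pairing of the two halves of [k], at most n
     |k|^2. *)
  rewrite (_ : _ - _ - _ = \sum_(i < n) k 0 (lshift n i) * k 0 (rshift n i)).
    apply: le_trans (ler_norm_sum _ _ _) _.
    apply: le_trans (ler_sum _ (_ : forall i, true -> _ <= `|k| * `|k|)) _.
      by move=> i _; rewrite normrM ler_pM // rV_coord_le.
    rewrite sumr_const card_ord -[leLHS]mulr_natl mulrA ler_wpM2r //.
    apply: le_trans (_ : n%:R * (eps / (n%:R + 1)) <= _).
      by rewrite ler_wpM2l.
    rewrite mulrA ler_pdivrMr ?ltr_wpDl // mulrC.
    by rewrite ler_pM2l // lerDl.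
  rewrite big_split_ord /= /qP opprD addrA -!sumrB; apply: eq_bigr => i _.
  by rewrite row_mxEl row_mxEr !mxE; ring.
split => //; apply/rowP => i; rewrite mxE; exact: dqE.
Qed.

(** Write d for increments. The increment of P . Q is P . dQ + Q . dP + dP . dQ, and subtracting the
    action expansion with error r cancels P . dQ. There remain Q . dP + p . dq, linear in k = (dq,
    dP), and dP . dQ - r, quadratic in k because the inverse of [psi] and the flow are Lipschitz at
    the base point. *)
Lemma generating_function (H : V -> R) (t : R) (U : set V) :
  C2 H -> 0 <= t -> qP_chart H t U ->
  exists S : V -> R, forall x, U x -> differentiable S (psi H t x) /\
    grad S (psi H t x) = row_mx (rsubmx x) (lsubmx (flow H t x)).
Proof.
move=> H_C2 t0 [oU [domU [_ [oW [_ [_ [g [gpsi [psig [dg _]]]]]]]]]].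
pose f := flow H t.
exists (fun y => \sum_(i < n) f (g y) 0 (rshift n i) * f (g y) 0 (lshift n i) -
  action H t (g y)) => x Ux.
set S := (fun y => _); set y := psi H t x.
have Wy : (psi H t @` U) y by exists x.
have [|dS dSE] := @rV_functional_expansion R _ S y
    (row_mx (rsubmx x) (lsubmx (f x))); last first.
  by split => //; apply/rowP => i; rewrite mxE; exact: dSE.
have [G [d1 [G0 d10 hG]]] := differentiable_lipschitz (dg y Wy).
have /nbhs_ballP[d2 /= d20 hd2] := open_nbhs_nbhs (conj oW Wy).
have [C3 [d3 [C30 d30 hA]]] := action_expansion H_C2 t0 (domU x Ux).
have [B [C4 [d4 [C40 d40 hF]]]] := flow_nearby H_C2 t0 (domU x Ux).
pose M := n%:R * (C4 * G) ^+ 2 + C3 * G ^+ 2.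
have M0 : 0 < M.
  apply: ltr_wpDl; first by rewrite mulr_ge0 ?sqr_ge0.
  by rewrite mulr_gt0 ?exprn_gt0.
move=> eps eps0.
exists (Num.min (Num.min d1 (d2 / 2)) (Num.min (Num.min (d3 / G) (d4 / G))
  (eps / M))).
split; first by rewrite !lt_min d10 !divr_gt0.
move=> k; rewrite !le_min => /andP[/andP[k1 k2] /andP[/andP[k3 k4] k5]].
have Wyk : (psi H t @` U) (y + k).
  apply: hd2; rewrite -ball_normE /= opprD addrA subrr sub0r normrN.
  by apply: le_lt_trans k2 _; lra.
have [Ux' psix'] := psig _ Wyk; set x' := g (y + k) in Ux' psix' *.
have gy : g y = x by exact: gpsi.
have h_le : `|x' - x| <= G * `|k| by rewrite -gy; exact: hG.
have h3 : `|x' - x| <= d3.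
  by apply: le_trans h_le _; rewrite mulrC -ler_pdivlMr.
have h4 : `|x' - x| <= d4.
  by apply: le_trans h_le _; rewrite mulrC -ler_pdivlMr.
have [_ _ /(_ t)] := hF x' h4; rewrite t0 lexx => /(_ isT) hf.
have {}hf : `|f x' - f x| <= C4 * G * `|k|.
  by apply: le_trans hf _; rewrite -mulrA ler_pM2l.
have := hA x' h3; set r := (X in `|X| <= _) => r_le.
have kE : k = psi H t x' - psi H t x by rewrite psix' addrC addKr.
have kl i : k 0 (lshift n i) = (x' - x) 0 (lshift n i).
  by rewrite kE /psi opp_row_mx add_row_mx row_mxEl !mxE.
have kr i : k 0 (rshift n i) = (f x' - f x) 0 (rshift n i).
  by rewrite kE /psi opp_row_mx add_row_mx row_mxEr !mxE.
have -> : S (y + k) - S y -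
    \sum_i k 0 i * (row_mx (rsubmx x) (lsubmx (f x))) 0 i =
    \sum_(i < n) (f x' - f x) 0 (rshift n i) * (f x' - f x) 0 (lshift n i) - r.
  rewrite /S gy -/x' /r big_split_ord /=.
  set a := \sum_i _; set b := \sum_i _; set c := \sum_i _; set c' := \sum_i _.
  set e := \sum_i _; set e1 := \sum_i _; set e2 := \sum_i _.
  suff : a - b - c - c' = e + e1 - e2 by rewrite -/f; lra.
  rewrite -!sumrB -!big_split /= -sumrB; apply: eq_bigr => i _.
  by rewrite kl kr row_mxEl row_mxEr !mxE; ring.
apply: (@le_trans _ _ (M * `|k| ^+ 2)).
  apply: le_trans (ler_normB _ _) _; rewrite mulrDl lerD //.
    apply: le_trans (ler_norm_sum _ _ _) _.
    apply: le_trans (ler_sum _ (_ : forall i, true ->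
      _ <= (C4 * G) ^+ 2 * `|k| ^+ 2)) _.
      move=> i _; rewrite normrM -exprMn expr2 ler_pM //.
        exact: le_trans (rV_coord_le _ _) hf.
      exact: le_trans (rV_coord_le _ _) hf.
    by rewrite sumr_const card_ord -[leLHS]mulr_natl mulrA.
  apply: le_trans r_le _; rewrite -mulrA ler_pM2l // -exprMn.
  by rewrite ler_pXn2r ?nnegrE // mulr_ge0 // ltW.
by rewrite expr2 mulrA ler_wpM2r // mulrC -ler_pdivlMr.
Qed.

End flow_jacobian.

Lemma grad_scaled_sub_qP (R : realType) (n : nat) (S : 'rV[R]_(n + n) -> R)
    (c : R) (y : 'rV[R]_(n + n)) : differentiable S y ->
  grad (fun z => c * (S z - qP z)) y =
  c *: (grad S y - row_mx (rsubmx y) (lsubmx y)).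
Proof.
move=> dS; have [dq <-] := grad_qP y.
apply/rowP => i; rewrite !mxE; apply: (@derive_val _ _ _ _ _ _ _).
apply: is_derive_cmulf.
exact: (is_derive_subf (derivableP (diff_derivable (v := delta_mx 0 i) dS))
  (derivableP (diff_derivable dq))).
Qed.

Lemma psi_mulmx (R : realType) (n : nat) (H : 'rV[R]_(n + n) -> R) (t : R) x :
  x *m (I1mx R n)^T + flow H t x *m (I2mx R n)^T = psi H t x.
Proof.
rewrite /I1mx /I2mx /psi !tr_block_mx !trmx0 !trmx1.
rewrite -[in X in X *m _ + _](hsubmxK x) -[in X in _ + X *m _](hsubmxK (flow H t x)).
by rewrite !mul_row_block !mulmx0 !mulmx1 !addr0 !add0r add_row_mx addr0 add0r.
Qed.

Lemma mulmx_Jmx (R : realType) (n : nat) (a : 'rV[R]_(n + n)) :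
  a *m Jmx R n = row_mx (- rsubmx a) (lsubmx a).
Proof.
rewrite /Jmx -[in LHS](hsubmxK a) mul_row_block !mulmx0 !mulmx1 add0r addr0.
by rewrite mulmxN mulmx1.
Qed.

(** The sign of [LK] is read off the threshold: a negative value would make log 2 / LK negative and
    leave no room for a positive t. *)
Lemma lt_DTstar (R : realType) (n : nat) (H : 'rV[R]_(n + n) -> R)
    (K : set 'rV[R]_(n + n)) (T : \bar R) (t : R) : 0 < t ->
  (t%:E < DTstar H K T)%E ->
  [/\ (t%:E <= T)%E, 0 <= LK H K & expR (LK H K * t) < 2].
Proof.
move=> t0; rewrite /DTstar; case: eqP => [->|/eqP L0].
  by move=> /ltW tT; split; rewrite ?mul0r ?expR0 // ltr1n.
rewrite lt_min => /andP[/ltW tT]; rewrite lte_fin => tL.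
have ln2 : 0 < ln (2 : R) by rewrite ln_gt0 // ltr1n.
have L_gt0 : 0 < LK H K.
  rewrite lt_neqAle eq_sym L0 leNgt /=; apply/negP => Lneg.
  have : ln (2 : R) / LK H K <= 0 by rewrite nmulr_lle0 ?invr_lt0 // ltW.
  by rewrite leNgt (lt_trans t0 tL).
split => //; first exact: ltW.
rewrite -[ltRHS](@lnK _ 2) ?posrE // ltr_expR mulrC.
by rewrite -ltr_pdivlMr.
Qed.

Unset Implicit Arguments.

Theorem theorem4 (R : realType) (n : nat) (H : 'rV[R]_(n + n) -> R)
    (K : set 'rV[R]_(n + n)) (T : \bar R) :
  C2 H -> K !=set0 -> compact K -> (0 < T)%E ->
  (forall (t : R) (x : 'rV[R]_(n + n)), 0 <= t -> (t%:E <= T)%E -> K x ->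
     flow_dom H t x /\ K (flow H t x)) ->
  forall dT : R, 0 < dT -> (dT%:E < DTstar H K T)%E ->
    (forall x, K x -> drsubmx (jac (flow H dT) x) \in unitmx) /\
    (forall U : set 'rV[R]_(n + n),
       qP_chart H dT U -> U `&` K !=set0 ->
       simply_connected (psi H dT @` U) ->
       (forall x, U x -> drsubmx (jac (flow H dT) x) \in unitmx) /\
       diffeo_onto (psi H dT) U /\ open (psi H dT @` U) /\
       simply_connected (psi H dT @` U) /\
       exists S : 'rV[R]_(n + n) -> R,
         (forall y, (psi H dT @` U) y -> differentiable S y) /\
         (forall x, U x ->
            rsubmx x = lsubmx (grad S (psi H dT x)) /\
            lsubmx (flow H dT x) = rsubmx (grad S (psi H dT x))) /\
         (forall x, U x ->
            (dT^-1 *: (flow H dT x - x)) *m Jmx R n =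
            grad (fun y => dT^-1 * (S y - qP y))
                 (x *m (I1mx R n)^T + flow H dT x *m (I2mx R n)^T))).
Proof.
move=> H_C2 K0 cK T0 inv dT dT0 dT_lt.
have dT_ge0 := ltW dT0; have [dTT L0 Lexp] := lt_DTstar dT0 dT_lt.
split=> [x Kx|U chart _ sc].
  apply: (flow_jac_unit_invariant H_C2 cK dT_ge0 _ _ L0 Lexp).
    exact: (inv dT x dT_ge0 dTT Kx).1.
  (* Invariance is used at every intermediate time, because the Hessian bound has to hold along the
     whole trajectory. *)
  move=> s /andP[s0 sdT]; apply: (inv s x s0 _ Kx).2.
  by apply: le_trans dTT; rewrite lee_fin.
have [_ [_ dif]] := chart; have [_ [oW _]] := dif.
split; first by move=> x; exact: flow_jac_unit_chart chart.
do 3 split => //.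
have [S hS] := generating_function H_C2 dT_ge0 chart.
exists S; split; first by move=> _ [x Ux <-]; exact: (hS x Ux).1.
split=> x Ux; have [dS gradS] := hS x Ux.
  by rewrite gradS row_mxKl row_mxKr.
(* The action of J^T on columns is right multiplication by [Jmx] on rows; both sides become (p - P,
   Q - q) / dT. *)
rewrite psi_mulmx grad_scaled_sub_qP // gradS -scalemxAl mulmx_Jmx.
rewrite /psi row_mxKl row_mxKr opp_row_mx add_row_mx; congr (_ *: row_mx _ _).
  by rewrite linearB /= opprB.
by rewrite linearB.
Qed.
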